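(* Let $U\subset\mathbb R^n$ be an open set which is locally uniformly quasiconvex. Then $\mathrm N_U\colon\mathcal{DM}^{\mathrm{ext}}(U)\to\text{Æ}(\partial U)$ is surjective. More precisely, there exist a discrete set $\Lambda\subset U$ and a constant $C$ such that for each $m\in\text{Æ}(\partial U)$ there exists $\boldsymbol F\in\mathcal{DM}^{\mathrm{ext}}(U)$ such that $\mathrm N_U(\boldsymbol F)=m$, $\operatorname{div}\boldsymbol F$ is supported on $\Lambda$ (i.e. $|\operatorname{div}\boldsymbol F|(U\setminus\Lambda)=0$), and $$\|\boldsymbol F\|_{\mathcal{DM}^{\mathrm{ext}}(U)}\le C\|m\|_{\text{Æ}(\partial U)}.$$
   Context: Throughout $n\ge2$. For $U\subset\mathbb R^n$ open, $\mathcal{DM}^{\mathrm{ext}}(U)$ is the space of finite $\mathbb R^n$-valued Radon measures $\boldsymbol F$ on $U$ whose distributional divergence $\operatorname{div}\boldsymbol F$ is a finite signed Radon measure on $U$, with norm $\|\boldsymbol F\|_{\mathcal{DM}^{\mathrm{ext}}(U)}=|\boldsymbol F|(U)+|\operatorname{div}\boldsymbol F|(U)$. An open set $U\subset\mathbb R^n$ is locally uniformly quasiconvex if there exist $\varepsilon,\delta>0$ such that for any distinct $p,q\in\overline U$ with $|p-q|<\delta$ there is a rectifiable curve $\gamma\colon[0,1]\to\mathbb R^n$ with $\gamma(0)=p$, $\gamma(1)=q$, $\gamma(t)\in U$ for all $t\in(0,1)$, whose length satisfies $\ell(\gamma)\le\varepsilon^{-1}|p-q|$. For $X\subset\mathbb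 R^n$ closed, $\mathrm{Lip}_{\mathrm b}(X)$ is the space of bounded Lipschitz functions with norm $\max\{\sup_X|\phi|,\mathrm{Lip}(\phi,X)\}$, and the Arens–Eells space $\text{Æ}(X)$ is the completion (norm closure) of $\mathrm{span}\{\delta_x:x\in X\}$ in $\mathrm{Lip}_{\mathrm b}(X)^*$ with the dual norm, denoted $\|\cdot\|_{\text{Æ}(X)}$. The normal trace $\mathrm N_U(\boldsymbol F)$ of $\boldsymbol F\in\mathcal{DM}^{\mathrm{ext}}(U)$ is the unique element of $\text{Æ}(\partial U)$ with $\langle\mathrm N_U(\boldsymbol F),\phi|_{\partial U}\rangle=-\int_U\nabla\phi\cdot\mathrm d\boldsymbol F-\int_U\phi\,\mathrm d(\operatorname{div}\boldsymbol F)$ for all $\phi\in C^1_{\mathrm b}(U)$ ($C^1$ functions, bounded with bounded gradient; when $U$ is locally uniformly quasiconvex such $\phi$ are Lipschitz on $U$ and $\phi|_{\partial U}$ is the restriction of the continuous extension to $\overline U$). *)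

(* Defs.v *)
From HB Require Import structures.
From mathcomp Require Import all_boot all_order all_algebra.
From mathcomp Require Import all_classical all_reals all_analysis.

Set Implicit Arguments.
Unset Strict Implicit.
Unset Printing Implicit Defensive.

Import Order.TTheory GRing.Theory Num.Theory.
Import numFieldNormedType.Exports.

Local Open Scope classical_set_scope.
Local Open Scope ring_scope.

(* R^n is 'rV[R]_n.  Its library norm `|v| is the sup norm (same topology);
   all metric quantities below use the Euclidean norm instead. *)
Definition enorm (R : realType) (n : nat) (v : 'rV[R]_n) : R :=
  Num.sqrt (\sum_(i < n) v ord0 i ^+ 2).

Definition boundary (T : topologicalType) (U : set T) : set T :=
  closure U `\` interior U.

Definition discrete_set (T : topologicalType) (A : set T) : Prop :=
  A `<=` isolated A.

Section quasiconvexity.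
Context {R : realType} {n : nat}.
Implicit Types (U : set 'rV[R]_n) (g : R -> 'rV[R]_n).

Definition curve_length g (a b : R) : \bar R :=
  ereal_sup [set (\sum_(0 <= k < size s)
      enorm (g (nth b (a :: s) k.+1) - g (nth b (a :: s) k)))%:E
    | s in itv_partition a b].

(* The curves are functions on R of which only the values on [0, 1] matter;
   rectifiability is the finiteness of curve_length, a consequence of the
   upper bound. *)
Definition locally_uniformly_quasiconvex U : Prop :=
  exists eps delta : R, [/\ 0 < eps, 0 < delta &
    forall p q : 'rV[R]_n, closure U p -> closure U q -> p <> q ->
      enorm (p - q) < delta ->
      exists g : R -> 'rV[R]_n,
        [/\ {within `[0, 1], continuous g}, g 0 = p, g 1 = q,
            forall t : R, 0 < t < 1 -> U (g t) &
            (curve_length g 0 1 <= (eps^-1 * enorm (p - q))%:E)%E]].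

End quasiconvexity.

Section differentiability_classes.
Context {R : realType} {n : nat}.
Implicit Types (f : 'rV[R]_n -> R) (U : set 'rV[R]_n).

Definition partial (i : 'I_n) f : 'rV[R]_n -> R :=
  fun x => 'D_(delta_mx ord0 i) f x.

Definition grad f (x : 'rV[R]_n) : 'rV[R]_n := \row_(i < n) partial i f x.

Definition smooth f : Prop :=
  forall (s : seq 'I_n) (x : 'rV[R]_n), differentiable (foldr partial f s) x.

(* C_c^oo(U), its elements being extended by 0 outside U. *)
Definition test_function U f : Prop :=
  let supp := closure [set x | f x != 0] in
  [/\ smooth f, compact supp & supp `<=` U].

(* C^1_b(U); the values of f outside the open set U are irrelevant. *)
Definition C1b U f : Prop :=
  [/\ forall x, U x -> differentiable f x,
      forall (i : 'I_n) x, U x -> {for x, continuous (partial i f)},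
      exists M : R, forall x, U x -> `|f x| <= M &
      exists M : R, forall x, U x -> enorm (grad f x) <= M].

End differentiability_classes.

Section integration_against_charges.
Context d (T : measurableType d) (R : realType).
Implicit Types (nu : {charge set T -> \bar R}) (A : set T) (f : T -> R).

Lemma hahn_exists nu : exists PN, hahn_decomposition nu PN.1 PN.2.
Proof. by have [P [N PN]] := Hahn_decomposition nu; exists (P, N). Qed.

Definition hahn_sets nu : set T * set T := sval (cid (hahn_exists nu)).

Definition hahn_setsP nu :
  hahn_decomposition nu (hahn_sets nu).1 (hahn_sets nu).2 :=
  svalP (cid (hahn_exists nu)).

(* |nu|; does not depend on the Hahn decomposition.  Only meaningful on
   measurable sets. *)
Definition charge_abs nu : set T -> \bar R := charge_variation (hahn_setsP nu).

Definition charge_Rintegral nu A f : R :=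
  Rintegral (jordan_pos (hahn_setsP nu)) A f -
  Rintegral (jordan_neg (hahn_setsP nu)) A f.

Definition vector_charge (n : nat) := 'I_n -> {charge set T -> \bar R}.

Definition vector_charge_abs n (F : vector_charge n) A : \bar R :=
  ereal_sup [set (\sum_(0 <= k <oo)
      (enorm (\row_(i < n) fine (F i (E k))))%:E)%E
    | E in [set E : (set T)^nat |
        [/\ forall k, measurable (E k), trivIset setT E & \bigcup_k E k = A]]].

(* \int_A G . dF *)
Definition vector_charge_integral n (F : vector_charge n) A (G : T -> 'rV[R]_n)
    : R :=
  \sum_(i < n) charge_Rintegral (F i) A (fun x => G x ord0 i).

Definition concentrated_on nu A : Prop :=
  forall B, measurable B -> B `&` A = set0 -> nu B = 0%E.

End integration_against_charges.

Notation borel R n := (g_sigma_algebraType (@open 'rV[R]_n)).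

Section divergence_measure_fields.
Context {R : realType} {n : nat}.

(* A finite signed Borel measure on an open subset of R^n is automatically
   Radon.  Measures on U are represented by their extension by zero to R^n.
   The divergence is determined by dm_field; it is bundled for convenience. *)
Record DMext (U : set 'rV[R]_n) := {
  dm_field :> vector_charge (borel R n) R n;
  dm_div : {charge set (borel R n) -> \bar R};
  dm_field_concentrated : forall i, concentrated_on (dm_field i) U;
  dm_div_concentrated : concentrated_on dm_div U;
  dm_divP : forall phi, test_function U phi ->
    charge_Rintegral dm_div U phi =
    - vector_charge_integral dm_field U (grad phi) }.

Definition DMext_norm U (F : DMext U) : \bar R :=
  (vector_charge_abs F U + charge_abs (dm_div F) U)%E.

End divergence_measure_fields.

Section bounded_lipschitz.
Context {R : realType} {n : nat} (X : set 'rV[R]_n).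

Definition lipb_pred : {pred X -> R^o} := [pred f | `[<
  (exists M : R, forall x : X, `|f x| <= M) /\
  (exists L : R, forall x y : X,
     `|f x - f y| <= L * enorm (\val x - \val y)) >] ].

Record lipb := LipB { lipb_fun :> X -> R^o; _ : lipb_fun \in lipb_pred }.

HB.instance Definition _ := [isSub for lipb_fun].
HB.instance Definition _ := [Choice of lipb by <:].

Lemma lipb_submod_closed : submod_closed lipb_pred.
Proof.
split=> [|a f g].
  by apply/asboolP; split; exists 0 => x; rewrite ?normr0// => y;
    rewrite subrr normr0 mul0r.
move=> /asboolP[[M fM] [L fL]] /asboolP[[M' gM] [L' gL]].
apply/asboolP; split.
  exists (`|a| * M + M') => x; rewrite (le_trans (ler_normD _ _))// lerD//.
  by rewrite normrM ler_wpM2l.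
exists (`|a| * L + L') => x y.
have -> : (a *: f + g) x - (a *: f + g) y = a * (f x - f y) + (g x - g y).
  by rewrite !fctE /= mulrBr opprD addrACA.
rewrite (le_trans (ler_normD _ _))// mulrDl lerD// normrM -mulrA.
by rewrite ler_wpM2l.
Qed.

HB.instance Definition _ :=
  GRing.isSubmodClosed.Build _ _ lipb_pred lipb_submod_closed.
HB.instance Definition _ := [SubChoice_isSubLmodule of lipb by <:].

(* In R, sup set0 = 0, so that lipb_norm = 0 when X is empty. *)
Definition lipb_norm (f : lipb) : R :=
  Num.max (sup [set `|f x| | x in [set: X]])
    (sup [set r | exists x y : X, x <> y /\
                  r = `|f x - f y| / enorm (\val x - \val y)]).

Definition dual_norm (m : lipb -> R) : \bar R :=
  ereal_sup [set `|m f|%:E | f in [set f | lipb_norm f <= 1]].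

(* Sum of the a *: delta_x, for (a, x) in s. *)
Definition delta_comb (s : seq (R * X)) (f : lipb) : R :=
  \sum_(ax <- s) ax.1 * f ax.2.

Record arens_eells := {
  ae_fun :> {linear lipb -> R^o};
  ae_bounded : (dual_norm ae_fun < +oo)%E;
  ae_closure : forall e : R, 0 < e ->
    exists s : seq (R * X), (dual_norm (fun f => ae_fun f - delta_comb s f)%R < e%:E)%E }.

Definition ae_norm (m : arens_eells) : \bar R := dual_norm m.

End bounded_lipschitz.

Section normal_trace.
Context {R : realType} {n : nat} (U : set 'rV[R]_n).

(* psi is the restriction to the boundary of the continuous extension of
   phi : U -> R to the closure of U. *)
Definition boundary_value (phi : 'rV[R]_n -> R) (psi : lipb (boundary U))
    : Prop :=
  forall x : boundary U, phi @ within U (nbhs (\val x)) --> (psi x : R).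

Definition normal_trace_identity (F : DMext U) (m : arens_eells (boundary U))
    : Prop :=
  forall phi, C1b U phi ->
    exists2 psi : lipb (boundary U), boundary_value phi psi &
      m psi = - vector_charge_integral F U (grad phi)
              - charge_Rintegral (dm_div F) U phi.

(* The relation N_U(F) = m: m is the unique solution of the identity. *)
Definition is_normal_trace (F : DMext U) (m : arens_eells (boundary U)) : Prop :=
  normal_trace_identity F m /\
  forall m' : arens_eells (boundary U), normal_trace_identity F m' -> m' =1 m.

End normal_trace.

(* Main.v *)
Require Import Defs.
From HB Require Import structures.
From mathcomp Require Import all_boot all_order all_algebra.
From mathcomp Require Import all_classical all_reals all_analysis.
From mathcomp Require Import measurable_realfun ring lra.
Import Order.TTheory GRing.Theory Num.Theory.
Import numFieldNormedType.Exports.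

(** Why the normal trace is surjective.

    Line integrals have point evaluations as traces.  The tangential length
    measure of a segment from [a] to [b] in [U], tested against the gradient of
    [phi], gives [phi b - phi a].  A curve in [U] joining two boundary points
    [x] and [y] therefore carries a field without divergence in [U], whose mass
    is the length of the curve and whose normal trace is, up to the sign, the
    difference of the point evaluations at [x] and [y].  Quasiconvexity bounds
    this length by a multiple of [|x - y|] when [x] and [y] are close.  A single
    point evaluation at [x] is the trace of a curve which starts at a point of
    [U], and that point is then the support of the divergence.  The starting
    points are taken in a maximal separated subset [Lambda] of [U]: it is
    discrete, and maximality puts a point of [Lambda] at a bounded distance from
    every boundary point.  Altogether (flux_boundary) the functionals [phi x]
    and [phi x - phi y] are obtained at costs [c] and [c |x - y|], where the
    cost counts the mass of the field and of its divergence.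

    From there on the argument is the duality between transport and Lipschitz
    functions.  The least cost of a finite combination of point evaluations is
    a sublinear function of the coefficients.  The Hahn-Banach theorem in finite
    dimension supports it by a linear form, that is, by values at the points in
    question; the two bounds above say that these values are bounded by [c] and
    [c]-Lipschitz, so that they extend to a function on the whole boundary.
    Hence the least cost is at most a multiple of the dual norm
    (flux_delta_comb).  An element of the Arens-Eells space is a series of
    finite combinations whose dual norms decrease geometrically, and fields
    whose costs are summable can be added (flux_series, flux_arens_eells).

    The extension of Lipschitz data from finitely many points is made by a
    smoothed McShane formula (smooth_mcshane), which produces a C^1 function.
    The same extension shows that an element of the Arens-Eells space is
    determined by its values on traces of C^1 functions (normal_trace_unique),
    which is the uniqueness part of the definition of the normal trace. *)

Set Implicit Arguments.
Unset Strict Implicit.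
Unset Printing Implicit Defensive.
Local Open Scope classical_set_scope.
Local Open Scope ring_scope.

(** * The Euclidean norm on row vectors *)

Section euclidean_norm.
Context {R : realType} {n : nat}.
Implicit Types v w : 'rV[R]_n.

Lemma enorm_ge0 v : 0 <= enorm v.
Proof. exact: sqrtr_ge0. Qed.

Lemma sqr_enorm v : enorm v ^+ 2 = \sum_(i < n) v ord0 i ^+ 2.
Proof. by rewrite sqr_sqrtr// sumr_ge0// => i _; exact: sqr_ge0. Qed.

Lemma enormN v : enorm (- v) = enorm v.
Proof. by congr Num.sqrt; apply: eq_bigr => i _; rewrite mxE sqrrN. Qed.

Lemma enormC v w : enorm (v - w) = enorm (w - v).
Proof. by rewrite -enormN opprB. Qed.

Lemma enorm0 : enorm (0 : 'rV[R]_n) = 0.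
Proof. by rewrite /enorm big1 ?sqrtr0// => i _; rewrite mxE expr0n. Qed.

Lemma coord_le_enorm v i : `|v ord0 i| <= enorm v.
Proof.
rewrite -sqrtr_sqr ler_sqrt ?sumr_ge0//; last by move=> j _; exact: sqr_ge0.
by rewrite (bigD1 i)//= lerDl sumr_ge0// => j _; exact: sqr_ge0.
Qed.

Lemma enorm_eq0 v : enorm v = 0 -> v = 0.
Proof.
move=> v0; apply/rowP => i; rewrite mxE.
by apply/eqP; rewrite -normr_le0 -v0; exact: coord_le_enorm.
Qed.

(** The vector [enorm w ^+ 2 *: v - T *: w], with [T] the inner product, is
    orthogonal to [w]; its squared norm is a nonnegative multiple of the
    difference of the two sides. *)
Lemma cauchy_schwarz v w :
  \sum_(i < n) v ord0 i * w ord0 i <= enorm v * enorm w.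
Proof.
set T := \sum_(i < n) _.
have [/eqP /enorm_eq0 w0|wn0] := boolP (enorm w == 0).
  by rewrite /T big1 ?mulr_ge0 ?enorm_ge0// => i _; rewrite w0 mxE mulr0.
have wgt0 : 0 < enorm w by rewrite lt_def wn0 enorm_ge0.
rewrite (le_trans (ler_norm _))// -ler_sqr ?nnegrE ?mulr_ge0 ?enorm_ge0//.
rewrite real_normK ?num_real// exprMn.
have : 0 <= \sum_(i < n) (enorm w ^+ 2 * v ord0 i - T * w ord0 i) ^+ 2.
  by apply: sumr_ge0 => i _; exact: sqr_ge0.
have -> : \sum_(i < n) (enorm w ^+ 2 * v ord0 i - T * w ord0 i) ^+ 2 =
    enorm w ^+ 2 * (enorm v ^+ 2 * enorm w ^+ 2 - T ^+ 2).
  transitivity (\sum_(i < n) (enorm w ^+ 4 * (v ord0 i ^+ 2) -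
      (2 * enorm w ^+ 2 * T) * (v ord0 i * w ord0 i) + T ^+ 2 * w ord0 i ^+ 2)).
    by apply: eq_bigr => i _; ring.
  by rewrite big_split sumrB/= -!mulr_sumr -!sqr_enorm -/T; ring.
by rewrite pmulr_rge0 ?exprn_gt0// subr_ge0.
Qed.

Lemma enormD v w : enorm (v + w) <= enorm v + enorm w.
Proof.
rewrite -ler_sqr ?nnegrE ?addr_ge0 ?enorm_ge0//.
have -> : enorm (v + w) ^+ 2 =
    enorm v ^+ 2 + 2 * (\sum_(i < n) v ord0 i * w ord0 i) + enorm w ^+ 2.
  rewrite !sqr_enorm mulr_sumr -!big_split/=.
  by apply: eq_bigr => i _; rewrite mxE; ring.
have := cauchy_schwarz v w; lra.
Qed.

Lemma enorm_le_sum v : enorm v <= \sum_(i < n) `|v ord0 i|.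
Proof.
rewrite -[leRHS]ger0_norm ?sumr_ge0// -sqrtr_sqr ler_sqrt ?sqr_ge0//.
suff : \sum_(i < n) v ord0 i ^+ 2 <= (\sum_(i < n) `|v ord0 i|) ^+ 2 /\
  0 <= \sum_(i < n) `|v ord0 i| by case.
elim/big_ind2 : _ => [|a x b y [ax x0] [byb y0]|i _].
- by rewrite expr0n.
- split; last exact: addr_ge0.
  have := mulr_ge0 x0 y0; rewrite sqrrD; lra.
- by rewrite real_normK// num_real.
Qed.

Lemma coord_le_norm v i : `|v ord0 i| <= `|v|.
Proof.
rewrite [leRHS]mx_normrE.
exact: (le_bigmax 0 (fun ij : 'I_1 * 'I_n => `|v ij.1 ij.2|) (ord0, i)).
Qed.

Lemma sum_coord_le_enorm v : \sum_(i < n) `|v ord0 i| <= n%:R * enorm v.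
Proof.
rewrite (le_trans (ler_sum _ (fun i _ => coord_le_enorm v i)))//.
by rewrite sumr_const card_ord mulr_natl.
Qed.

Lemma enorm_le_norm v : enorm v <= n%:R * `|v|.
Proof.
rewrite (le_trans (enorm_le_sum v))//.
rewrite (le_trans (ler_sum _ (fun i _ => coord_le_norm v i)))//.
by rewrite sumr_const card_ord mulr_natl.
Qed.

End euclidean_norm.

(** * The Hahn-Banach theorem in finite dimension *)

Section hahn_banach.
Context {R : realType}.

(** Homogeneity is stated as an inequality, which is all that has to be
    checked of a cost; equality follows (sublinearZ). *)
Definition sublinear (V : lmodType R) (p : V -> R) :=
  (forall v w, p (v + w) <= p v + p w) /\
  (forall (t : R) v, 0 <= t -> p (t *: v) <= t * p v).

Section sublinear.
Variables (V : lmodType R) (p : V -> R).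
Hypothesis sp : sublinear p.

Lemma sublinear0 : p 0 = 0.
Proof.
have [pD pZ] := sp; have := pD 0 0; have := pZ 0 0 (lexx _).
rewrite scale0r mul0r addr0; lra.
Qed.

Lemma sublinearN_ge v : - p (- v) <= p v.
Proof. have [pD _] := sp; have := pD v (- v); rewrite subrr sublinear0; lra. Qed.

Lemma sublinearZ (t : R) v : 0 <= t -> p (t *: v) = t * p v.
Proof.
have [_ pZ] := sp; rewrite le_eqVlt => /predU1P[<-|t0].
  by rewrite scale0r mul0r sublinear0.
apply/eqP; rewrite eq_le pZ ?(ltW t0)//=.
have ti0 : 0 <= t^-1 by rewrite invr_ge0 ltW.
have := pZ t^-1 (t *: v) ti0.
rewrite scalerA mulVf; last by rewrite gt_eqF.
by rewrite scale1r ler_pdivlMl.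
Qed.

(** Subtracting from [p] its slope in the direction [e], in the form
    [q v = inf_t (p (v + t e) - t p e)] over [t >= 0], keeps it sublinear and
    makes it linear along [e] without lowering its value at [e]. *)
Lemma sublinear_linearize e : exists q : V -> R,
  [/\ sublinear q, forall v, q v <= p v & q (- e) <= - p e].
Proof.
have [pD pZ] := sp.
pose S v := [set p (v + t *: e) - t * p e | t in [set t : R | 0 <= t]].
pose q v := inf (S v).
have S0 v : S v !=set0 by exists (p (v + 0 *: e) - 0 * p e), 0 => /=.
have lbS v : lbound (S v) (- p (- v)).
  move=> _ [t /= t0 <-]; have := pD (v + t *: e) (- v).
  rewrite addrAC subrr add0r sublinearZ//; lra.
have qS v t : 0 <= t -> q v <= p (v + t *: e) - t * p e.
  by move=> t0; apply: ge_inf; [exists (- p (- v))|exists t].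
have qp v : q v <= p v.
  by have := qS v 0 (lexx _); rewrite scale0r mul0r addr0 subr0.
exists q; split=> //; last first.
  by have := qS (- e) 1 ler01; rewrite scale1r addNr sublinear0 mul1r add0r.
split=> [v w|t v].
  rewrite -lerBlDr; apply: lb_le_inf => // _ [s /= s0 <-].
  rewrite lerBlDl -lerBlDr; apply: lb_le_inf => // _ [t /= t0 <-].
  have := qS (v + w) (s + t) (addr_ge0 s0 t0).
  have := pD (v + s *: e) (w + t *: e).
  by rewrite addrACA -scalerDl; lra.
rewrite le_eqVlt => /predU1P[<-|t0].
  by rewrite scale0r mul0r (le_trans (qp _))// sublinear0.
rewrite -ler_pdivrMl//; apply: lb_le_inf => // _ [s /= s0 <-].
rewrite ler_pdivrMl//; have := qS (t *: v) (t * s) (mulr_ge0 (ltW t0) s0).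
by rewrite -scalerA -scalerDr sublinearZ ?(ltW t0)// mulrBr mulrA.
Qed.

End sublinear.

(** Linearity along a vector survives the passage to a smaller sublinear
    function, so that the directions can be treated one after the other. *)
Lemma sublinear_linearize_seq (V : lmodType R) (s : seq V) (p : V -> R) :
  sublinear p -> exists q : V -> R,
  [/\ sublinear q, forall v, q v <= p v &
      forall e, e \in s -> q (- e) <= - q e].
Proof.
elim: s p => [|e s IH] p sp; first by exists p; split.
have [q [sq qp qe]] := sublinear_linearize sp e.
have [r [sr rq rs]] := IH q sq.
exists r; split=> // [v|w]; first exact: le_trans (rq v) (qp v).
rewrite inE => /predU1P[->|]; last exact: rs.
have := rq e; have := rq (- e); have := qp e; lra.
Qed.

(** Linearizing along [v0] first preserves the value at [v0]; linearizing then
    along a basis gives a linear form, and its coefficients are [f]. *)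
Lemma hahn_banach_rV k (p : 'rV[R]_k -> R) (v0 : 'rV[R]_k) : sublinear p ->
  exists f : 'I_k -> R, (forall v : 'rV[R]_k, \sum_i v ord0 i * f i <= p v) /\
    p v0 <= \sum_i v0 ord0 i * f i.
Proof.
move=> sp; have [q1 [sq1 q1p q1v0]] := sublinear_linearize sp v0.
have [q [sq qq1 qe]] :=
  sublinear_linearize_seq [seq delta_mx ord0 i | i <- enum 'I_k] sq1.
have [qD qZ] := sq.
have qE v : q v <= \sum_i v ord0 i * q (delta_mx ord0 i).
  rewrite [v in leLHS]row_sum_delta.
  elim/big_ind2 : _ => [|x a y b xa yb|i _]; first by rewrite sublinear0.
    exact: le_trans (qD _ _) (lerD xa yb).
  have [vi0|vi0] := leP 0 (v ord0 i); first exact: qZ.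
  have nvi0 : 0 <= - v ord0 i by rewrite oppr_ge0 ltW.
  have de : delta_mx ord0 i \in [seq delta_mx ord0 j : 'rV[R]_k | j <- enum 'I_k].
    by apply: map_f; rewrite mem_enum.
  have := le_trans (qZ _ (- delta_mx ord0 i) nvi0) (ler_wpM2l nvi0 (qe _ de)).
  by rewrite scaleNr scalerN opprK mulrNN.
exists (fun i => q (delta_mx ord0 i)); split=> [v|].
  have := qE (- v); under eq_bigr do rewrite mxE mulNr.
  rewrite sumrN; have := sublinearN_ge sq v; have := qq1 v; have := q1p v; lra.
have := qE v0; have := sublinearN_ge sq v0; have := qq1 (- v0); lra.
Qed.
End hahn_banach.

(** * Maximal separated sets *)

Section separated.
Context {R : realType} {V : normedModType R}.

Definition separated_by (r : R) (A : set V) :=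
  forall x y, A x -> A y -> x <> y -> r <= `|x - y|.

(** A maximal set among those which are separated by [r] is also an [r]-net. *)
Lemma maximal_separated (U : set V) (r : R) : 0 < r ->
  exists A : set V, [/\ A `<=` U, separated_by r A &
    forall u, U u -> exists2 a, A a & `|u - a| < r].
Proof.
move=> r0; pose P (A : set V) := A `<=` U /\ separated_by r A.
have [F FP totF|A [[AU sA] Amax]] := @Zorn_bigcup V P.
  split=> [x [B FB Bx]|x y [B FB Bx] [C FC Cy]].
    by have [+ _] := FP _ FB; exact.
  have [BC|CB] := totF _ _ FB FC.
    by have [_ +] := FP _ FC; apply => //; exact: BC.
  by have [_ +] := FP _ FB; apply => //; exact: CB.
exists A; split=> // u Uu; apply: contrapT => far.
have farA a : A a -> r <= `|u - a|.
  by move=> Aa; rewrite leNgt; apply/negP => ua; apply: far; exists a.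
have Au : ~ A u by move=> /farA; rewrite subrr normr0 leNgt r0.
apply: (Amax (A `|` [set u])); last split.
- by split=> [x ?|/(_ u (or_intror erefl))//]; left.
- by move=> x [/AU//|->].
- move=> x y [Ax|->] [Ay|->] xy //; first exact: sA.
  + by rewrite distrC; exact: farA.
  + exact: farA.
Qed.

Lemma separated_discrete r A : 0 < r -> separated_by r A -> discrete_set A.
Proof.
move=> r0 sA x Ax; split; first exact: mem_set.
exists (ball x r); first exact: nbhsx_ballx.
apply/seteqP; split=> [y [xy Ay]|_ ->]; last by split=> //; exact: ballxx.
apply: contrapT => yx; move: xy; rewrite -ball_normE/= ltNge => /negP; apply.
by apply: sA => // xy; apply: yx.
Qed.

(** A limit point of [A] outside of [A] would be the limit of infinitely many
    points of [A], any two of which are close to each other. *)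
Lemma separated_closed r A : 0 < r -> separated_by r A -> closed A.
Proof.
move=> r0 sA x clx.
have r20 : 0 < r / 2 by rewrite divr_gt0.
have [y [Ay xy]] := clx _ (nbhsx_ballx x _ r20).
have [->//|yx] := eqVneq x y.
have e0 : 0 < Num.min (r / 2) `|x - y|.
  by rewrite lt_min r20 normr_gt0 subr_eq0.
have [z [Az]] := clx _ (nbhsx_ballx x _ e0).
move: xy; rewrite -!ball_normE/= lt_min => xy /andP[xz xzy].
have yz : y <> z by move=> yz; rewrite yz ltxx in xzy.
have := sA _ _ Ay Az yz.
have := ler_distD x y z; rewrite (distrC y x); lra.
Qed.

End separated.

(** * Extension of Lipschitz data by C^1 functions *)

Section c1_functions.
Context {R : realType} {n : nat}.
Implicit Types (f g : 'rV[R]_n -> R) (x : 'rV[R]_n).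

Definition C1 f := (forall x, differentiable f x) /\
  (forall i, continuous (partial i f)).

Lemma C1_cst (c : R) : C1 (cst c).
Proof.
split=> [x|i]; first exact: differentiable_cst.
have -> : partial i (cst c) = cst 0.
  by apply/funext => x; rewrite /partial derive_cst.
exact: cst_continuous.
Qed.

Lemma C1D f g : C1 f -> C1 g -> C1 (f \+ g).
Proof.
move=> [df cf] [dg cg]; split=> [x|i]; first exact: differentiableD.
have -> : partial i (f \+ g) = partial i f \+ partial i g.
  by apply/funext => x; rewrite /partial deriveD//; exact: diff_derivable.
by move=> x; exact: cvgD (cf i x) (cg i x).
Qed.

Lemma partial_comp (h dh : R -> R) f i x : differentiable f x ->
  is_derive (f x) 1 h (dh (f x)) ->
  partial i (h \o f) x = dh (f x) * partial i f x.
Proof.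
move=> df dhf.
have dh' : differentiable h (f x) by apply/derivable1_diffP; case: dhf.
rewrite /partial deriveE; last exact: differentiable_comp.
by rewrite diff_comp//= diff1E//= derive1E derive_val mulrC deriveE.
Qed.

(** The derivative of the outer function is prescribed at the values of [f]
    only: the square root is differentiable away from zero. *)
Lemma C1_comp (h dh : R -> R) f :
  (forall x, is_derive (f x) 1 h (dh (f x))) ->
  (forall x, {for f x, continuous dh}) -> C1 f -> C1 (h \o f).
Proof.
move=> dhf cdh [df cf]; split=> [x|i].
  apply: differentiable_comp => //; apply/derivable1_diffP.
  by case: (dhf x).
have -> : partial i (h \o f) = (dh \o f) \* partial i f.
  by apply/funext => x; exact: partial_comp.
move=> x; apply: cvgM (cf i x).
apply: continuous_comp (cdh x).
exact: differentiable_continuous.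
Qed.

Lemma C1Z (a : R) f : C1 f -> C1 (fun x => a * f x).
Proof.
apply: (@C1_comp ( *%R a) (cst a)) => x; last exact: cst_continuous.
have -> : *%R a = a *: (@id R) by [].
by apply: is_derive_eq; rewrite /cst/= /GRing.scale/= mulr1.
Qed.

Lemma C1_sqr f : C1 f -> C1 (fun x => f x ^+ 2).
Proof.
apply: (@C1_comp (fun u => u ^+ 2) (fun u => 2 * u)) => x.
  have -> : (fun u : R => u ^+ 2) = (@id R) ^+ 2 by [].
  by apply: is_derive_eq; rewrite /GRing.scale/= mulr1 expr1.
by apply: cvgM; [exact: cvg_cst|exact: cvg_id].
Qed.

Lemma C1_coord i : C1 (fun x => x ord0 i).
Proof.
split=> [x|j]; first exact: differentiable_coord.
have -> : partial j (fun x => x ord0 i) = cst ((j == i)%:R).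
  apply/funext => x; rewrite /partial /derive; apply: cvg_lim => //.
  apply: cvg_near_cst; near=> h; rewrite /= !mxE addrK eqxx/= eq_sym.
  by rewrite /GRing.scale/= mulKf//; near: h; exact: nbhs_dnbhs_neq.
exact: cst_continuous.
Unshelve. all: by end_near. Qed.

Lemma C1_sqrt_addr (e : R) f : 0 < e -> (forall x, 0 <= f x) -> C1 f ->
  C1 (fun x => Num.sqrt (f x + e ^+ 2)).
Proof.
move=> e0 f0 Cf.
have pos x : 0 < f x + e ^+ 2 by rewrite ltr_wpDl// exprn_gt0.
apply: (@C1_comp Num.sqrt (fun u => (2 * Num.sqrt u)^-1)
  (fun x => f x + e ^+ 2)).
- by move=> x; exact: is_derive1_sqrt.
- move=> x; apply: cvgV; first by rewrite mulf_neq0 ?gt_eqF ?sqrtr_gt0.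
  by apply: cvgM; [exact: cvg_cst|exact: sqrt_continuous].
- exact: C1D Cf (C1_cst _).
Qed.

Lemma C1_sum (I : Type) (s : seq I) (F : I -> 'rV[R]_n -> R) :
  (forall i, C1 (F i)) -> C1 (fun x => \sum_(i <- s) F i x).
Proof.
move=> CF; elim: s => [|i s IH].
  by under eq_fun do rewrite big_nil; exact: C1_cst.
under eq_fun do rewrite big_cons; exact: C1D (CF i) IH.
Qed.

Lemma enorm_delta (h : R) (i : 'I_n) : enorm (h *: delta_mx ord0 i) = `|h|.
Proof.
rewrite /enorm (bigD1 i)//= big1 ?addr0 => [|j ji].
  by rewrite !mxE !eqxx mulr1 sqrtr_sqr.
by rewrite !mxE eqxx (negbTE ji) mulr0 expr0n.
Qed.

Lemma lipschitz_partial_le (L : R) f x i : 0 <= L -> differentiable f x ->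
  (forall x y, `|f x - f y| <= L * enorm (x - y)) -> `|partial i f x| <= L.
Proof.
move=> L0 df lf.
have cf : derivable f x (delta_mx ord0 i) by exact: diff_derivable.
have q h : h != 0 -> `|h^-1 *: (f (h *: delta_mx ord0 i + x) - f x)| <= L.
  move=> h0; rewrite normrM normfV ler_pdivrMl ?normr_gt0// mulrC.
  by rewrite -(enorm_delta h i) (le_trans (lf _ _))// addrK.
rewrite ler_norml; apply/andP; split.
  apply: limr_ge => //; near=> h.
  have /q : h != 0 by near: h; exact: nbhs_dnbhs_neq.
  by rewrite ler_norml => /andP[].
apply: limr_le => //; near=> h.
have /q : h != 0 by near: h; exact: nbhs_dnbhs_neq.
by rewrite ler_norml => /andP[].
Unshelve. all: by end_near. Qed.

End c1_functions.

Section smoothed_minimum.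
Context {R : realType}.
Implicit Types a b e u v : R.

Definition sabs e u := Num.sqrt (u ^+ 2 + e ^+ 2).

Lemma sabs_sqr e u : sabs e u ^+ 2 = u ^+ 2 + e ^+ 2.
Proof. by rewrite sqr_sqrtr// addr_ge0 ?sqr_ge0. Qed.

Lemma sabs_ge e u : `|u| <= sabs e u.
Proof. by rewrite -sqrtr_sqr ler_sqrt ?addr_ge0 ?sqr_ge0// lerDl sqr_ge0. Qed.

Lemma sabs_ge0 e u : 0 <= sabs e u.
Proof. exact: sqrtr_ge0. Qed.

Lemma sabs_le e u : 0 <= e -> sabs e u <= `|u| + e.
Proof.
move=> e0; rewrite -ler_sqr ?nnegrE ?addr_ge0 ?sabs_ge0//.
rewrite sabs_sqr sqrrD real_normK ?num_real// lerD2r lerDl.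
by rewrite mulrn_wge0// mulr_ge0.
Qed.

Lemma sabs_lipschitz e u v : `|sabs e u - sabs e v| <= `|u - v|.
Proof.
wlog : u v / sabs e v <= sabs e u.
  by move=> W; have [/W//|/ltW/W] := leP (sabs e v) (sabs e u);
    rewrite distrC (distrC u).
move=> vu; rewrite ger0_norm ?subr_ge0// lerBlDr addrC.
rewrite -ler_sqr ?nnegrE ?addr_ge0 ?sabs_ge0// sqrrD !sabs_sqr.
have uv : `|u| <= `|v| + `|u - v|.
  by rewrite -[in leLHS](subrK v u) addrC ler_normD.
have := ler_pM (normr_ge0 u) (normr_ge0 u) uv uv.
rewrite -!expr2 sqrrD !real_normK ?num_real//.
have := ler_wpM2r (normr_ge0 (u - v)) (sabs_ge e v).
rewrite !mulr2n; lra.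
Qed.

(** The minimum of [a] and [b] is [(a + b - |a - b|) / 2]. *)
Definition smin e a b := (a + b - sabs e (a - b)) / 2.

Lemma smin_le e a b : smin e a b <= Num.min a b.
Proof.
rewrite le_min; have := sabs_ge e (a - b); rewrite ler_norml => /andP[h1 h2].
have := ler_norm (a - b); have := ler_norm (b - a); rewrite (distrC b).
have := sabs_ge e (a - b).
by rewrite /smin => *; apply/andP; split; lra.
Qed.

Lemma smin_ge e a b : 0 <= e -> Num.min a b - e <= smin e a b.
Proof.
move=> e0; have := sabs_le (a - b) e0; rewrite /smin.
have [ab|/ltW ab] := leP a b.
  by rewrite distrC ger0_norm ?subr_ge0//; lra.
by rewrite ger0_norm ?subr_ge0//; lra.
Qed.

Lemma smin_lipschitz e a b a' b' d : `|a - a'| <= d -> `|b - b'| <= d ->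
  `|smin e a b - smin e a' b'| <= d.
Proof.
have := sabs_lipschitz e (a - b) (a' - b'); rewrite /smin.
set s := sabs _ _; set s' := sabs _ _.
have [h|h] := leP 0 (a - b - (a' - b')).
  rewrite (ger0_norm h) !ler_norml => /andP[? ?] /andP[? ?] /andP[? ?].
  by apply/andP; split; lra.
rewrite (ltr0_norm h) !ler_norml => /andP[? ?] /andP[? ?] /andP[? ?].
by apply/andP; split; lra.
Qed.

End smoothed_minimum.

Section smooth_mcshane.
Context {R : realType} {n : nat}.
Implicit Types (s : seq ('rV[R]_n * R)) (L M e : R).

Lemma C1_smin e (f g : 'rV[R]_n -> R) : 0 < e -> C1 f -> C1 g ->
  C1 (fun x => smin e (f x) (g x)).
Proof.
move=> e0 Cf Cg.
have Cfg : C1 (fun x => f x - g x).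
  rewrite (_ : (fun x => _) = f \+ (fun x => -1 * g x)).
    exact: (C1D Cf (C1Z (-1) Cg)).
  by apply/funext => x /=; rewrite mulN1r.
have Cs : C1 (fun x => sabs e (f x - g x)) :=
  C1_sqrt_addr e0 (fun x => sqr_ge0 (f x - g x)) (C1_sqr Cfg).
rewrite (_ : (fun x => _) =
    (fun x => 2^-1 * (f x + (g x + -1 * sabs e (f x - g x))))).
  exact: (C1Z 2^-1 (C1D Cf (C1D Cg (C1Z (-1) Cs)))).
by apply/funext => x; rewrite /smin mulN1r mulrC addrA.
Qed.

Lemma C1_scone e (x0 : 'rV[R]_n) : 0 < e ->
  C1 (fun x => sabs e (enorm (x - x0))).
Proof.
move=> e0.
have Csq : C1 (fun x => enorm (x - x0) ^+ 2).
  under eq_fun do rewrite sqr_enorm.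
  apply: C1_sum => i; apply: C1_sqr.
  under eq_fun do rewrite !mxE.
  exact: (C1D (C1_coord i) (C1_cst (- x0 ord0 i))).
exact: (C1_sqrt_addr e0 (fun x => sqr_ge0 (enorm (x - x0))) Csq).
Qed.

Lemma scone_lipschitz e (x0 x y : 'rV[R]_n) :
  `|sabs e (enorm (x - x0)) - sabs e (enorm (y - x0))| <= enorm (x - y).
Proof.
apply: le_trans (sabs_lipschitz _ _ _) _.
have h1 : enorm (x - x0) <= enorm (x - y) + enorm (y - x0).
  by rewrite (le_trans _ (enormD _ _))// addrA subrK.
have h2 : enorm (y - x0) <= enorm (x - y) + enorm (x - x0).
  by rewrite (enormC x y) (le_trans _ (enormD _ _))// addrA subrK.
by rewrite ler_norml; apply/andP; split; lra.
Qed.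

(** The McShane extension is the minimum over [p] in [s] of the cones
    [p.2 + L |x - p.1|]; here both the cones and the binary minimum are replaced
    by smooth approximations, which remain [L]-Lipschitz.  The last conclusion
    says that [g] lies, up to [e], above the truncated McShane extension, since
    that is the largest [r] allowed by the two premises. *)
Lemma smooth_mcshane s L M e : 0 <= L -> 0 < e ->
  exists g : 'rV[R]_n -> R, [/\ C1 g,
    forall x y, `|g x - g y| <= L * enorm (x - y),
    forall x, g x <= M,
    forall p, p \in s -> g p.1 <= p.2 + e &
    forall x r, r <= M ->
      (forall p, p \in s -> r <= p.2 + L * enorm (x - p.1)) -> r - e <= g x].
Proof.
move=> L0; elim: s e => [|[x0 y0] s IH] e e0.
  exists (cst M); split=> // [|x y|x r rM _].
  - exact: C1_cst.
  - by rewrite subrr normr0 mulr_ge0// enorm_ge0.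
  - by rewrite /= lerBlDr (le_trans rM)// lerDl ltW.
have e20 : 0 < e / 2 by rewrite divr_gt0.
have [g [Cg lg gM gle gge]] := IH _ e20.
have L10 : 0 < L + 1 by rewrite ltr_wpDl.
(* the smoothed cone exceeds the cone by at most [L * t] at its apex *)
pose t := e / 2 / (L + 1); have t0 : 0 < t by rewrite divr_gt0.
have Lt : L * t <= e / 2.
  by rewrite /t mulrCA ler_piMr ?ltW// ltr_pdivrMr// mul1r ltrDl.
pose c x := y0 + L * sabs t (enorm (x - x0)).
have lc x y : `|c x - c y| <= L * enorm (x - y).
  rewrite /c opprD addrACA subrr add0r -mulrBr normrM ger0_norm//.
  by rewrite ler_wpM2l// scone_lipschitz.
exists (fun x => smin (e / 2) (g x) (c x)); split.
- exact: (C1_smin e20 Cg (C1D (C1_cst y0) (C1Z L (C1_scone x0 t0)))).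
- by move=> x y; exact: smin_lipschitz.
- by move=> x; have := smin_le (e / 2) (g x) (c x);
    rewrite le_min => /andP[/le_trans h _]; exact: h.
- move=> p; rewrite inE => /predU1P[->|ps]/=.
    have := smin_le (e / 2) (g x0) (c x0); rewrite le_min => /andP[_ /le_trans].
    apply; rewrite /c subrr enorm0.
    have /= := ler_wpM2l L0 (sabs_le 0 (ltW t0)).
    by rewrite normr0 add0r; lra.
  have := smin_le (e / 2) (g p.1) (c p.1); rewrite le_min => /andP[h _].
  by have := gle p ps; lra.
- move=> x r rM H.
  apply: le_trans (smin_ge _ _ (ltW e20)).
  suff : r - e / 2 <= Num.min (g x) (c x) by lra.
  rewrite le_min; apply/andP; split.
    by apply: gge => // p ps; apply: H; rewrite inE ps orbT.
  have := H _ (mem_head _ _); rewrite /c/=.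
  have := ler_wpM2l L0 (sabs_ge t (enorm (x - x0))).
  rewrite ger0_norm ?enorm_ge0//; lra.
Qed.

Lemma smooth_lipschitz_extension s L M e : 0 <= L -> 0 <= M -> 0 < e ->
  (forall p, p \in s -> `|p.2| <= M) ->
  (forall p q, p \in s -> q \in s -> p.2 <= q.2 + L * enorm (p.1 - q.1)) ->
  exists g : 'rV[R]_n -> R, [/\ C1 g,
    forall x y, `|g x - g y| <= L * enorm (x - y),
    forall x, `|g x| <= M + e &
    forall p, p \in s -> `|g p.1 - p.2| <= e].
Proof.
move=> L0 M0 e0 sM sL.
have [g [Cg lg gM gle gge]] := smooth_mcshane s M L0 e0.
exists g; split=> // [x|p ps].
  rewrite ler_norml (le_trans (gM x)) ?lerDl ?(ltW e0)// andbT opprD.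
  apply: gge => [|p ps]; first by rewrite (le_trans _ M0)// oppr_le0.
  have := sM _ ps; rewrite ler_norml => /andP[+ _].
  have : 0 <= L * enorm (x - p.1) by rewrite mulr_ge0// enorm_ge0.
  lra.
rewrite ler_norml lerBlDl gle// andbT lerBrDr addrC.
apply: gge => [|q qs]; first exact: le_trans (ler_norm _) (sM _ ps).
exact: sL.
Qed.

End smooth_mcshane.

(** * Integration against finite Borel measures *)

Section borel_functions.
Context {R : realType} {n : nat}.
Local Notation T := (borel R n).
Implicit Types (U : set 'rV[R]_n) (f : 'rV[R]_n -> R).

Lemma open_borel U : open U -> measurable (U : set T).
Proof. exact: sub_sigma_algebra. Qed.

Lemma closed_borel U : closed U -> measurable (U : set T).
Proof.
move=> cU; rewrite -(setCK U); apply: measurableC; apply: open_borel.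
exact: closed_openC.
Qed.

Lemma measurable_fun_open U f : open U ->
  (forall x, U x -> {for x, continuous f}) -> measurable_fun (U : set T) f.
Proof.
move=> oU cf; apply: (measurability _ (RGenOInfty.measurableE R)) => //.
move=> _ [_ [r ->] <-].
apply: open_borel; rewrite openE => x [Ux fx].
apply: filterI; first exact: oU.
apply: (cf x Ux); apply: open_nbhs_nbhs; split=> //.
Qed.

Lemma continuous_borel (g : R -> 'rV[R]_n) : continuous g ->
  measurable_fun setT (g : R -> T).
Proof.
move=> cg; apply: (measurability _ (erefl : @measurable _ T = <<s open >>)).
move=> _ [A oA <-]; rewrite setTI; apply: open_measurable.
by move/continuousP : cg; exact.
Qed.

End borel_functions.

Section finite_measure_integrals.
Context d (T : measurableType d) (R : realType).
Implicit Types (mu : {measure set T -> \bar R}) (D : set T) (f : T -> R).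

Lemma bounded_integrable mu D f (M : R) : measurable D -> (mu setT < +oo)%E ->
  measurable_fun D f -> (forall x, D x -> `|f x| <= M) ->
  mu.-integrable D (EFin \o f).
Proof.
move=> mD muT mf fM; apply: measurable_bounded_integrable => //.
  by apply: le_lt_trans muT; apply: le_measure; rewrite ?inE.
exists M; split=> [|r Mr x Dx]; first exact: num_real.
exact: le_trans (fM x Dx) (ltW Mr).
Qed.

Lemma finite_measure_le mu A : measurable A -> (mu setT < +oo)%E ->
  mu A \is a fin_num.
Proof.
move=> mA muT; rewrite ge0_fin_numE//; apply: le_lt_trans muT.
by apply: le_measure; rewrite ?inE.
Qed.

(** A bounded function differs from a nonnegative one by a constant, so that
    identities proved for nonnegative integrands carry over. *)
Lemma Rintegral_shift mu D f (M : R) : measurable D -> (mu setT < +oo)%E ->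
  measurable_fun D f -> (forall x, D x -> `|f x| <= M) ->
  \int[mu]_(x in D) f x = \int[mu]_(x in D) (f x + M) - M * fine (mu D).
Proof.
move=> mD muT mf fM; rewrite RintegralD//.
- by rewrite Rintegral_cst// addrK.
- exact: bounded_integrable fM.
- by apply: (@bounded_integrable _ _ _ `|M|).
Qed.

Lemma cvg_Rintegral_mseries (mu_ : {measure set T -> \bar R}^nat) D f (M : R) :
  measurable D -> (mseries mu_ 0 setT < +oo)%E ->
  measurable_fun D f -> (forall x, D x -> `|f x| <= M) ->
  (fun K => \sum_(k < K) \int[mu_ k]_(x in D) f x) @ \oo -->
  \int[mseries mu_ 0]_(x in D) f x.
Proof.
move=> mD muT mf fM.
have mukT k : (mu_ k setT < +oo)%E.
  apply: le_lt_trans muT; apply: le_trans (nneseries_lim_ge k.+1 _) => //.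
  by rewrite big_nat_recr//= leeDr// sume_ge0.
have ge0case (g : T -> R) (N : R) : measurable_fun D g ->
    (forall x, D x -> 0 <= g x <= N) ->
    (fun K => \sum_(k < K) \int[mu_ k]_(x in D) g x) @ \oo -->
    \int[mseries mu_ 0]_(x in D) g x.
  move=> mg gN.
  have gN' x : D x -> `|g x| <= N by move=> /gN /andP[g0]; rewrite ger0_norm.
  have g0 x : D x -> (0 <= (g x)%:E)%E by move=> /gN /andP[].
  have ig : (mseries mu_ 0).-integrable D (EFin \o g).
    exact: bounded_integrable gN'.
  have igk k : (mu_ k).-integrable D (EFin \o g).
    exact: bounded_integrable gN'.
  have e : (\int[mseries mu_ 0]_(x in D) (g x)%:E =
      \sum_(k <oo) \int[mu_ k]_(x in D) (g x)%:E)%E.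
    by apply: ge0_integral_measure_series => //; exact/measurable_EFinP.
  have fin := integrable_fin_num mD ig; rewrite /= e in fin.
  rewrite [X in _ --> X]/Rintegral e.
  have /fine_cvg : (fun K => \sum_(0 <= k < K) \int[mu_ k]_(x in D) (g x)%:E)%E
      @ \oo --> (fine (\sum_(k <oo) \int[mu_ k]_(x in D) (g x)%:E)%E)%:E.
    rewrite fineK//; apply: is_cvg_ereal_nneg_natsum => k _.
    exact: integral_ge0.
  apply: cvg_trans; apply: near_eq_cvg; near=> K.
  rewrite /= big_mkord -sum_fine// => k _.
  exact: integrable_fin_num (igk k).
pose g x := f x + M.
have mg : measurable_fun D g by apply: measurable_funD.
have cg := ge0case g (M + M) mg.
rewrite (Rintegral_shift mD muT mf fM).
under eq_cvg.
  move=> K; under eq_bigr do rewrite (Rintegral_shift mD (mukT _) mf fM).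
  rewrite sumrB -mulr_sumr; over.
apply: cvgB.
  apply: cg => x /fM; rewrite ler_norml /g => /andP[? ?].
  by apply/andP; split; lra.
apply: cvgMr.
have : (fun K => \sum_(k < K) \int[mu_ k]_(x in D) (cst 1 x)) @ \oo -->
  \int[mseries mu_ 0]_(x in D) (cst 1 x).
  by apply: (ge0case _ 1) => // x _; rewrite ler01 lexx.
rewrite Rintegral_cst// mul1r; apply: cvg_trans; apply: near_eq_cvg.
by near=> K => /=; apply: eq_bigr => k _; rewrite Rintegral_cst// mul1r.
Unshelve. all: by end_near. Qed.

Lemma Rintegral_mscale (a : {nonneg R}) mu D f (M : R) : measurable D ->
  (mu setT < +oo)%E -> measurable_fun D f -> (forall x, D x -> `|f x| <= M) ->
  \int[mscale a mu]_(x in D) f x = a%:num * \int[mu]_(x in D) f x.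
Proof.
move=> mD muT mf fM.
have amuT : (mscale a mu setT < +oo)%E.
  by rewrite /mscale/= lte_mul_pinfty.
have muD := finite_measure_le mD muT.
rewrite (Rintegral_shift mD muT mf fM) (Rintegral_shift mD amuT mf fM).
have mg : measurable_fun D (fun x => f x + M) by apply: measurable_funD.
have ig : mu.-integrable D (EFin \o (fun x => f x + M)).
  apply: (@bounded_integrable _ _ _ (M + M)) => // x /fM.
  by rewrite !ler_norml => /andP[? ?]; apply/andP; split; lra.
rewrite {1}/Rintegral ge0_integral_mscale//; first last.
- move=> x /fM; rewrite lee_fin ler_norml => /andP[+ _]; lra.
- exact/measurable_EFinP.
rewrite fineM//; last exact: integrable_fin_num.
by rewrite /mscale/= fineM//= mulrBr mulrCA.
Qed.

End finite_measure_integrals.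

(** * Functionals represented by fields *)

Section flux.
Context {R : realType} {n : nat} (U Lambda : set 'rV[R]_n).
Hypothesis U_open : open U.
Local Notation T := (borel R n).
Local Notation mT := {measure set T -> \bar R}.
Implicit Types (ell : ('rV[R]_n -> R) -> R) (c : R) (phi : 'rV[R]_n -> R).

(** The functions against which a field and its divergence are integrated: the
    partial derivatives for the components of the field, and [phi] itself for
    the divergence. *)
Definition jet phi (o : option 'I_n) : 'rV[R]_n -> R :=
  if o is Some i then partial i phi else phi.

Lemma jet_continuous phi o x : C1b U phi -> U x -> {for x, continuous (jet phi o)}.
Proof.
case=> df cf _ _ Ux; case: o => [i|]; first exact: cf.
exact/differentiable_continuous/df.
Qed.

Lemma jet_bounded phi : C1b U phi ->
  exists M : R, forall o x, U x -> `|jet phi o x| <= M.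
Proof.
case=> _ _ [M HM] [N HN]; exists (Num.max M N) => -[i|] x Ux /=; last first.
  by rewrite le_max HM.
rewrite le_max (le_trans _ (HN x Ux)) ?orbT//.
have := coord_le_enorm (grad phi x) i; rewrite mxE; exact: le_trans.
Qed.

Lemma jet_measurable phi o : C1b U phi ->
  measurable_fun (U : set T) (jet phi o).
Proof. by move=> Cphi; apply: measurable_fun_open => // x; exact: jet_continuous. Qed.

Let mU : measurable (U : set T) := open_borel U_open.

Lemma jet_integrable (mu : mT) phi o : (mu setT < +oo)%E -> C1b U phi ->
  mu.-integrable (U : set T) (EFin \o jet phi o).
Proof.
move=> muT Cphi; have [M HM] := jet_bounded Cphi.
exact: (bounded_integrable mU muT (jet_measurable o Cphi) (HM o)).
Qed.

(** [Q (false, o)] and [Q (true, o)] are the positive and negative parts of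
    the component [o]. *)
Definition flux_integral (Q : bool * option 'I_n -> mT) phi : R :=
  \sum_(j : bool * option 'I_n) (-1) ^+ (j.1 : bool) * \int[Q j]_(x in U) jet phi j.2 x.

(** The functional [ell] is represented by a field of total mass at most [c],
    with divergence on [Lambda].  Pairs of positive measures replace signed
    ones since their masses and integrals are additive under countable sums.
    The field with normal trace [ell] is the opposite of the one given by [Q]. *)
Definition flux ell c : Prop := exists Q : bool * option 'I_n -> mT,
  [/\ forall j, Q j (~` U) = 0%E,
      forall b, Q (b, None) (~` Lambda) = 0%E,
      (\sum_j Q j setT <= c%:E)%E &
      forall phi, C1b U phi -> ell phi = flux_integral Q phi].

Lemma flux_lty (Q : bool * option 'I_n -> mT) c j :
  (\sum_j Q j setT <= c%:E)%E -> (Q j setT < +oo)%E.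
Proof.
move=> Qc; apply: le_lt_trans (ltry c); apply: le_trans Qc.
by rewrite (bigD1 j)//= leeDl// sume_ge0.
Qed.

Lemma flux_ext ell ell' c : (forall phi, C1b U phi -> ell phi = ell' phi) ->
  flux ell c -> flux ell' c.
Proof.
by move=> e [Q [? ? ? HQ]]; exists Q; split=> // phi Cphi; rewrite -e// HQ.
Qed.

Lemma flux_le ell c c' : c <= c' -> flux ell c -> flux ell c'.
Proof.
move=> cc' [Q [? ? Qc ?]]; exists Q; split=> //.
by apply: le_trans Qc _; rewrite lee_fin.
Qed.

Lemma flux_ge0 ell c : flux ell c -> 0 <= c.
Proof.
move=> [Q [_ _ Qc _]]; rewrite -lee_fin; apply: le_trans Qc.
by rewrite sume_ge0.
Qed.

Lemma flux_single (o : option 'I_n) (mu : mT) c : mu (~` U) = 0%E ->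
  (o = None -> mu (~` Lambda) = 0%E) -> (mu setT <= c%:E)%E ->
  flux (fun phi => \int[mu]_(x in U) jet phi o x) c.
Proof.
move=> muU muL muc.
exists (fun j => if j == (false, o) then mu else mzero); split.
- by move=> j; case: ifP.
- by move=> b; case: ifP => // /eqP[_ /esym /muL].
- rewrite (bigD1 (false, o))//= eqxx big1 ?adde0// => j /negbTE ->.
  by [].
- move=> phi Cphi; rewrite /flux_integral (bigD1 (false, o))//= eqxx mul1r.
  rewrite big1 ?addr0// => j /negbTE ->.
  by rewrite /Rintegral integral_measure_zero/= mulr0.
Qed.

Lemma flux0 : flux (fun=> 0) 0.
Proof.
exists (fun=> mzero); split=> // [|phi _].
  by rewrite big1.
rewrite /flux_integral big1// => j _.
by rewrite /Rintegral integral_measure_zero/= mulr0.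
Qed.

Lemma fluxN ell c : flux ell c -> flux (fun phi => - ell phi) c.
Proof.
pose s (j : bool * option 'I_n) := (~~ j.1, j.2).
have sK : involutive s by case=> b o; rewrite /s/= negbK.
move=> [Q [QU QL Qc HQ]]; exists (Q \o s); split=> //=.
- by move=> b; exact: QL.
- rewrite (reindex_inj (inv_inj sK))/=.
  by under eq_bigr do rewrite sK.
move=> phi Cphi; rewrite HQ// /flux_integral (reindex_inj (inv_inj sK))/=.
by rewrite -sumrN; apply: eq_bigr => -[b o] _ /=; rewrite signrN mulNr opprK.
Qed.

(** Costs being summable, the series of measures are finite, and the integrals
    of bounded functions commute with these series. *)
Lemma flux_series (ell_ : nat -> ('rV[R]_n -> R) -> R) (c_ : nat -> R) ell c :
  (forall k, flux (ell_ k) (c_ k)) -> (forall K, \sum_(k < K) c_ k <= c) ->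
  (forall phi, C1b U phi ->
    (fun K => \sum_(k < K) ell_ k phi) @ \oo --> ell phi) ->
  flux ell c.
Proof.
move=> fk ck cell.
have [Q_ HQ] := choice fk.
pose Q j : mT := mseries (fun k => Q_ k j) 0.
have Qc : (\sum_j Q j setT <= c%:E)%E.
  rewrite /Q /= /mseries -nneseries_sum//.
  apply: lime_le; first by apply: is_cvg_nneseries => k _ _; rewrite sume_ge0.
  apply: nearW => K; rewrite big_mkord.
  apply: (@le_trans _ _ (\sum_(k < K) (c_ k)%:E)%E).
    by apply: lee_sum => k _; have [] := HQ k.
  by rewrite sumEFin lee_fin.
exists Q; split=> //.
- by move=> j; apply: eseries0 => k _ _; have [] := HQ k.
- by move=> b; apply: eseries0 => k _ _; have [] := HQ k.
- move=> phi Cphi; have [M HM] := jet_bounded Cphi.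
  have := cell _ Cphi.
  have H : (fun K => \sum_(k < K) ell_ k phi) @ \oo --> flux_integral Q phi.
    rewrite (_ : (fun K => _) = fun K => \sum_(j : bool * option 'I_n) (-1) ^+ (j.1 : bool) *
        \sum_(k < K) \int[Q_ k j]_(x in U) jet phi j.2 x); last first.
      apply/funext => K.
      under [LHS]eq_bigr => k _ do rewrite (let: And4 _ _ _ h := HQ k in h _ Cphi).
      rewrite exchange_big/=; apply: eq_bigr => j _.
      by rewrite mulr_sumr.
    rewrite /flux_integral; apply: cvg_big => [|j _]; first exact: add_continuous.
    apply: cvgMr; apply: (@cvg_Rintegral_mseries _ T R (fun k => Q_ k j) U (jet phi j.2) M) => //.
    + exact: flux_lty Qc.
    + exact: jet_measurable.
    + exact: HM.
  by move=> /cvg_lim <-//; apply/cvg_lim.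
Qed.

Lemma fluxD ell1 c1 ell2 c2 : flux ell1 c1 -> flux ell2 c2 ->
  flux (fun phi => ell1 phi + ell2 phi) (c1 + c2).
Proof.
move=> f1 f2.
pose ell_ k := if k is 0 then ell1 else if k is 1 then ell2 else fun=> 0.
pose c_ k := if k is 0 then c1 else if k is 1 then c2 else 0.
have c10 := flux_ge0 f1; have c20 := flux_ge0 f2.
apply: (@flux_series ell_ c_).
- by case=> [//|[//|k]]; exact: flux0.
- case=> [|[|K]]; first by rewrite big_ord0 addr_ge0.
    by rewrite big_ord_recl big_ord0 addr0 lerDl.
  by rewrite !big_ord_recl/= big1 ?addr0.
- move=> phi _; apply: cvg_near_cst; exists 2 => // -[|[|K]]//= _.
  by rewrite !big_ord_recl/= big1 ?addr0.
Qed.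

Lemma flux_scale (a : R) ell c : flux ell c ->
  flux (fun phi => a * ell phi) (`|a| * c).
Proof.
wlog a0 : a / 0 <= a.
  move=> W fl; have [/W//|/ltW a0] := leP 0 a; first exact.
  have := fluxN (W (- a) _ fl); rewrite oppr_ge0 => /(_ a0).
  by rewrite normrN; apply: flux_ext => phi _; rewrite mulNr opprK.
rewrite ger0_norm//; move=> [Q [QU QL Qc HQ]].
exists (fun j => mscale (NngNum a0) (Q j)); split=> /=.
- by move=> j; rewrite /mscale/= QU mule0.
- by move=> j; rewrite /mscale/= QL mule0.
- by rewrite /mscale/= -ge0_sume_distrr// EFinM lee_wpmul2l.
- move=> phi Cphi; rewrite HQ// /flux_integral mulr_sumr.
  apply: eq_bigr => j _; rewrite mulrCA; congr (_ * _).
  have [M HM] := jet_bounded Cphi.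
  apply/esym/(Rintegral_mscale _ mU _ _ (HM j.2)); first exact: flux_lty Qc.
  exact: jet_measurable.
Qed.

Lemma flux_sum (I : Type) (s : seq I) (ell_ : I -> ('rV[R]_n -> R) -> R)
    (c_ : I -> R) : (forall i, flux (ell_ i) (c_ i)) ->
  flux (fun phi => \sum_(i <- s) ell_ i phi) (\sum_(i <- s) c_ i).
Proof.
move=> fi; elim: s => [|i s IH].
  rewrite big_nil; apply: flux_ext flux0 => phi _; by rewrite big_nil.
rewrite big_cons; apply: flux_ext (fluxD (fi i) IH) => phi _.
by rewrite big_cons.
Qed.

End flux.

(** * Segments and points *)

Section segment_measure.
Context {R : realType} {n : nat}.
Local Notation T := (borel R n).
Local Notation mT := {measure set T -> \bar R}.

(** The push-forward of the uniform probability on [0, 1] under the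
    parametrisation of the segment, seen only through its mass, its support and
    the change of variables. *)
Lemma segment_measure_exists (a v : 'rV[R]_n) : exists mu : mT,
  [/\ mu setT = 1%E,
      forall A : set T, measurable A ->
        (forall t, 0 <= t <= 1 -> ~ A (a + t *: v)) -> mu A = 0%E &
      forall (f : T -> R) (M : R), measurable_fun setT f ->
        (forall x, `|f x| <= M) ->
        \int[mu]_x f x = \int[lebesgue_measure]_(t in `[0, 1]) f (a + t *: v)].
Proof.
pose line (t : R) : T := a + t *: v.
have cline : continuous (line : R -> 'rV[R]_n).
  by move=> t; apply: cvgD; [exact: cvg_cst|apply: cvgZr_tmp; exact: cvg_id].
have mline : measurable_fun setT line by exact: continuous_borel.
pose P : {measure set _ -> \bar R} := uniform_prob (@ltr01 R).
pose mu_ := [the mT of pushforward P line]; pose mu : mT := mu_ mline.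
have muT : mu setT = 1%E.
  by rewrite /mu/= /pushforward preimage_setT; exact: probability_setT.
have muT' : (mu setT < +oo)%E by rewrite muT ltry.
have mI : measurable (`[0, 1]%classic : set R) by exact: measurable_itv.
have lI : @lebesgue_measure R (`[0, 1]%classic : set R) = 1%E.
  by rewrite lebesgue_measure_itv/= lte_fin ltr01 -EFinB subr0.
have mu_ge0 (f : T -> R) : measurable_fun setT f -> (forall x, 0 <= f x) ->
    \int[mu]_x f x = \int[lebesgue_measure]_(t in `[0, 1]) f (line t).
  move=> mf f0; rewrite /Rintegral ge0_integral_pushforward//; last first.
  - by move=> x _; rewrite lee_fin.
  - exact/measurable_EFinP.
  rewrite preimage_setT integral_uniform//.
  - by rewrite subr0 invr1 mul1e.
  - by apply/measurable_EFinP; exact: measurableT_comp.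
  - by move=> x; rewrite lee_fin.
exists mu; split=> // [A mA At|f M mf fM].
- rewrite /mu/= /pushforward /uniform_prob/= integral_uniform_pdf.
  rewrite (_ : _ `&` _ = set0) ?integral_set0//.
  by apply/seteqP; split=> t//= [lt]; rewrite in_itv/= => /At.
- have mfl : measurable_fun (`[0, 1]%classic : set R) (fun t : R => f (line t)).
    by apply: measurable_funTS; exact: measurableT_comp.
  rewrite (@Rintegral_shift _ _ _ mu _ _ M)// muT mulr1 mu_ge0//.
  + rewrite RintegralD//.
    * rewrite Rintegral_cst// (_ : fine _ = 1); last exact: (congr1 fine lI).
      by rewrite mulr1 addrK.
    * apply: measurable_bounded_integrable => //.
        by rewrite [X in (X < _)%E]lI ltry.
      exists M; split=> [|r Mr x _]; first exact: num_real.
      exact: le_trans (fM _) (ltW Mr).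
    * apply: measurable_bounded_integrable => //.
        by rewrite [X in (X < _)%E]lI ltry.
      exact: bounded_cst.
  + exact: measurable_funD.
  + by move=> x; have := fM x; rewrite ler_norml => /andP[+ _]; lra.
Qed.

End segment_measure.

Section flux_generators.
Context {R : realType} {n : nat} (U Lambda : set 'rV[R]_n).
Hypothesis U_open : open U.
Local Notation T := (borel R n).
Implicit Types (a v x : 'rV[R]_n) (phi : 'rV[R]_n -> R).

Lemma deriveE_partial phi x v : differentiable phi x ->
  'D_v phi x = \sum_i v ord0 i * partial i phi x.
Proof.
move=> dphi; rewrite deriveE// [v in LHS]row_sum_delta linear_sum.
by apply: eq_bigr => i _; rewrite linearZ/= /partial deriveE.
Qed.

Lemma FTC_segment phi a v : C1b U phi ->
  (forall t : R, 0 <= t <= 1 -> U (a + t *: v)) ->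
  \int[lebesgue_measure]_(t in `[0, 1])
    (\sum_i v ord0 i * partial i phi (a + t *: v)) = phi (a + v) - phi a.
Proof.
move=> Cphi Uav; have [dphi cphi _ _] := Cphi.
pose line (t : R) : 'rV[R]_n := a + t *: v.
pose F t := phi (line t).
pose f t := \sum_i v ord0 i * partial i phi (line t).
have dline (t : R) : is_diff t line ( *:%R ^~ v).
  have -> : ( *:%R ^~ v) = 0 + ( *:%R ^~ v) :> (R -> 'rV[R]_n) by rewrite add0r.
  exact: is_diffD (is_diff_cst a t) (is_diff_scalel t v).
have Fd (t : R) : 0 <= t <= 1 -> differentiable F t.
  move=> t01; apply: differentiable_comp; last exact/dphi/Uav.
  by have [? _] := dline t.
have F'f (t : R) : 0 <= t <= 1 -> F^`()%classic t = f t.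
  move=> t01; rewrite (derive1E' (Fd t t01)) /f.
  have dpt : differentiable phi (line t) by exact/dphi/Uav.
  have dlt : differentiable line t by have [? _] := dline t.
  rewrite (diff_comp dlt dpt).
  rewrite /= (@diff_val _ _ _ _ _ _ _ (dline t)) scale1r.
  by rewrite -deriveE// deriveE_partial.
have cF (t : R) : 0 <= t <= 1 -> {for t, continuous F}.
  by move=> /Fd; exact: differentiable_continuous.
have cf : {within `[0, 1], continuous f}.
  apply: continuous_in_subspaceT => t; rewrite inE/= in_itv/= => t01.
  rewrite /f; apply: cvg_big => [|i _]; first exact: add_continuous.
  apply: cvgMr; apply: (@continuous_comp _ _ _ line (partial i phi)).
    by apply: differentiable_continuous; have [? _] := dline t.
  exact/cphi/Uav.
have := continuous_FTC2 (@ltr01 R) cf _ _.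
rewrite /Rintegral => /(_ F) ->.
- by rewrite /= /F /line scale1r scale0r addr0.
- split.
  + move=> t; rewrite in_itv/= => /andP[/ltW t0 /ltW t1].
    by apply/derivable1_diffP/Fd; rewrite t0 t1.
  + by apply: cvg_at_right_filter; apply: cF; rewrite lexx ler01.
  + by apply: cvg_at_left_filter; apply: cF; rewrite lexx ler01.
- move=> t; rewrite in_itv/= => /andP[/ltW t0 /ltW t1].
  by apply: F'f; rewrite t0 t1.
Qed.

(** The [i]-th component of the field is [v_i] times the normalised length
    measure of the segment.  The factor [n] comes from bounding the sum of the
    absolute values of the coordinates by the Euclidean norm. *)
Lemma flux_segment a b : (forall t : R, 0 <= t <= 1 -> U (a + t *: (b - a))) ->
  flux U Lambda (fun phi => phi b - phi a) (n%:R * enorm (b - a)).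
Proof.
set v := b - a => Uav.
have [mu [muT muA mui]] := segment_measure_exists a v.
have mU := open_borel U_open.
have fi i := @flux_single _ _ U Lambda (Some i) mu 1.
have {fi} : flux U Lambda (fun phi => \sum_(i <- enum 'I_n)
    (v ord0 i * \int[mu]_(x in U) jet phi (Some i) x))
    (\sum_(i <- enum 'I_n) `|v ord0 i| * 1).
  apply: flux_sum => // i; apply: flux_scale => //; apply: fi => //.
  - apply: muA => [|t t01]; first exact: measurableC.
    by apply; exact: Uav.
  - by rewrite muT.
rewrite big_enum/= => fl; apply: flux_le (flux_ext _ fl).
  under eq_bigr do rewrite mulr1.
  exact: sum_coord_le_enorm.
move=> phi Cphi; rewrite big_enum/=.
have -> : phi b = phi (a + v) by rewrite /v addrC subrK.
rewrite -(FTC_segment Cphi Uav).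
have [M HM] := jet_bounded Cphi.
(* the derivatives are measurable on [U] only, and the push-forward formula
   asks for functions on the whole space *)
pose g i := (partial i phi) \_ U.
have mg i : measurable_fun setT (g i : T -> R).
  apply/(measurable_restrictT _ mU); exact: (jet_measurable U_open (Some i)).
have gM i x : `|g i x| <= `|M|.
  rewrite /g patchE; case: ifPn => [|_]; last by rewrite normr0.
  rewrite inE => Ux; apply: le_trans (ler_norm M); exact: (HM (Some i)).
transitivity (\sum_i \int[mu]_x (v ord0 i * g i x)).
  apply: eq_bigr => i _; rewrite RintegralZl//; last first.
    by apply: (bounded_integrable _ _ (mg i) (fun x _ => gM i x)) => //; rewrite muT ltry.
  by rewrite [in LHS]Rintegral_mkcond.
transitivity (\sum_i \int[lebesgue_measure]_(t in `[0, 1])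
    (v ord0 i * g i (a + t *: v))).
  apply: eq_bigr => i _.
  apply: (mui (fun x => v ord0 i * g i x) (`|v ord0 i| * `|M|)).
    exact: measurable_funM.
  by move=> x; rewrite normrM ler_wpM2l.
have iseg i : lebesgue_measure.-integrable `[0%R, 1%R]
    (EFin \o (fun t : R => v ord0 i * partial i phi (a + t *: v))).
  apply: continuous_compact_integrable; first exact: segment_compact.
  apply: continuous_in_subspaceT => t; rewrite inE/= in_itv/= => t01.
  pose line (r : R) : 'rV[R]_n := a + r *: v.
  apply: cvgMr; apply: (@continuous_comp _ _ _ line (partial i phi)).
    by apply: cvgD; [exact: cvg_cst|apply: cvgZr_tmp; exact: cvg_id].
  by case: Cphi => _ + _ _; apply; exact: Uav.
transitivity (\sum_i \int[lebesgue_measure]_(t in `[0, 1])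
    (v ord0 i * partial i phi (a + t *: v))).
  apply: eq_bigr => i _; apply: eq_Rintegral => t; rewrite inE/= in_itv/= => t01.
  by rewrite /g patchE mem_set//; exact: Uav.
rewrite /Rintegral sum_fine; last first.
  by move=> i _; apply: integrable_fin_num => //; exact: iseg.
rewrite -integral_sum//.
apply: (congr1 fine); apply: eq_integral => t _.
exact: sumEFin.
Qed.

Lemma flux_point x : U x -> Lambda x -> flux U Lambda (fun phi => phi x) 1.
Proof.
move=> Ux Lx; pose mu : {measure set T -> \bar R} := \d_(x : T).
have mU := open_borel U_open.
have d0 A : A x -> mu (~` A) = 0%E.
  move=> Ax; rewrite /mu/= diracE (_ : (x \in ~` A) = false)//.
  by apply: memNset => /(_ Ax).
have := @flux_single _ _ U Lambda None mu 1 (d0 _ Ux) (fun=> d0 _ Lx) _.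
rewrite /mu/= diracT => /(_ (lexx _)); apply: flux_ext => phi Cphi.
rewrite /Rintegral integral_dirac//.
  by rewrite diracE mem_set// mul1e.
by apply/measurable_EFinP; exact: (jet_measurable U_open None).
Qed.

(** Applied to segments, this is the mean value inequality. *)
Lemma flux_bound ell c phi (M : R) : flux U Lambda ell c -> C1b U phi ->
  (forall o x, U x -> `|jet phi o x| <= M) -> 0 <= M -> `|ell phi| <= M * c.
Proof.
move=> [Q [_ _ Qc HQ]] Cphi HM M0; rewrite HQ// /flux_integral.
have mU := open_borel U_open.
apply: le_trans (ler_norm_sum _ _ _) _.
apply: (@le_trans _ _ (\sum_j M * fine (Q j setT))).
  apply: ler_sum => j _; rewrite normrM normr_sign mul1r.
  have QT := flux_lty j Qc.
  apply: le_trans (le_normr_Rintegral _ _) _ => //.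
    exact: jet_integrable.
  have ij := jet_integrable U_open j.2 QT Cphi.
  apply: le_trans (_ : \int[Q j]_(x in U) M <= _).
    apply: le_Rintegral => //.
    - by have := integrable_abse ij.
    - by apply: (@bounded_integrable _ _ _ _ _ (cst M) `|M|) => //.
    - by move=> x Ux; exact: HM.
  rewrite Rintegral_cst// ler_wpM2l//.
  rewrite fine_le ?finite_measure_le//.
  by apply: le_measure; rewrite ?inE.
rewrite -mulr_sumr ler_wpM2l//.
rewrite sum_fine; last by move=> j _; apply: finite_measure_le => //; exact: flux_lty Qc.
rewrite -lee_fin fineK//.
rewrite ge0_fin_numE ?sume_ge0//; apply: le_lt_trans Qc _; exact: ltry.
Qed.

End flux_generators.

(** * Rectifiable curves as countable polygonal paths *)

Section chord_bounds.
Context {R : realType} {n : nat}.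
Implicit Types (g : R -> 'rV[R]_n) (l : R).

(** The consequence of rectifiability which is used: bounds for inscribed
    polygons, which need not start or end at the extremities of the curve. *)
Definition chord_bound g l := forall (t : nat -> R) (N : nat),
  0 < t 0 -> t N < 1 -> (forall k, (k < N)%N -> t k < t k.+1) ->
  \sum_(k < N) enorm (g (t k.+1) - g (t k)) <= l.

Lemma curve_length_chord_bound g l :
  (curve_length g 0 1 <= l%:E)%E -> chord_bound g l.
Proof.
move=> gl t N t0 tN tlt.
pose s := rcons [seq t k | k <- iota 0 N.+1] 1.
have szs : size s = N.+2 by rewrite size_rcons size_map size_iota.
have nths k : (k <= N)%N -> nth 1 s k = t k.
  move=> kN; rewrite nth_rcons size_map size_iota ltnS kN.
  by rewrite (nth_map 0%N) ?size_iota// nth_iota.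
have sN : nth 1 s N.+1 = 1.
  by rewrite nth_rcons size_map size_iota ltnn eqxx.
have ps : itv_partition 0 1 s.
  split; last by rewrite last_rcons.
  apply/(pathP 1) => -[|k]; rewrite szs ?ltnS => kN.
    by rewrite nths.
  rewrite [X in X < _](_ : _ = nth 1 s k)//.
  rewrite nths//; move: kN; rewrite leq_eqVlt => /predU1P[->|kN].
    by rewrite sN.
  by rewrite nths// tlt.
have : (\sum_(0 <= k < size s)
      enorm (g (nth 1 (0 :: s) k.+1) - g (nth 1 (0 :: s) k)) <= l).
  by rewrite -lee_fin; apply: le_trans gl; apply: ereal_sup_ubound; exists s.
apply: le_trans; rewrite szs big_mkord big_ord_recl big_ord_recr/=.
rewrite ler_wpDl ?enorm_ge0// ler_wpDr ?enorm_ge0//.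
apply: ler_sum => k _; rewrite /= add0n.
rewrite -[nth 1 (rcons _ _) _]/(nth 1 s k.+1) (nths k.+1)//.
by rewrite nths// ltnW.
Qed.

Lemma chord_bound_rev g l : chord_bound g l -> chord_bound (fun t => g (1 - t)) l.
Proof.
move=> gl t N t0 tN tlt.
have := gl (fun k => 1 - t (N - k)%N) N.
rewrite subn0 subnn subr_gt0 gtrBl => /(_ tN t0).
have h k : (k < N)%N -> (N - k)%N = (N - k.+1).+1 by move=> kN; rewrite subnSK.
move=> H; apply: le_trans (H _); last first.
  move=> k kN; rewrite ltrD2l ltrN2 (h _ kN); apply: tlt.
  by rewrite -h// leq_subr.
rewrite [leRHS](reindex_inj rev_ord_inj)/=.
apply: ler_sum => k _.
rewrite -(h k (ltn_ord k)) subKn ?(ltnW (ltn_ord k))// subKn//.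
by rewrite enormC.
Qed.

End chord_bounds.

Section greedy_subdivision.
Context {R : realType}.

(** Choose each step at least half as long as the longest admissible one.  If
    the points converged to some [c < 1], the lengths of the steps would tend to
    zero, although all the steps between points near [c] are admissible. *)
Lemma greedy_subdivision (P : R -> R -> Prop) :
  (forall c : R, 0 < c < 1 -> exists2 d : R, 0 < d &
    forall t s, `|t - c| < d -> `|s - c| < d -> P t s) ->
  exists t : nat -> R, [/\ t 0%N = 2^-1, forall k, t k < t k.+1,
    forall k, 0 < t k < 1, forall k, P (t k) (t k.+1) & t @ \oo --> (1 : R)].
Proof.
move=> HP.
have step (x : R) : exists y : R, 0 < x < 1 -> [/\ x < y, y < 1, P x y &
    forall z, x < z -> z < 1 -> P x z -> z - x <= 2 * (y - x)].
  have [x01|nx01] := boolP (0 < x < 1); last by exists 0 => x01; case/negP: nx01.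
  pose A := [set z | [/\ x < z, z < 1 & P x z]].
  have [d d0 Hd] := HP x x01; move: (x01) => /andP[x0 x1].
  have A0 : A !=set0.
    have m0 : 0 < Num.min d (1 - x) by rewrite lt_min d0 subr_gt0.
    have md : Num.min d (1 - x) <= d by rewrite ge_min lexx.
    have m1 : Num.min d (1 - x) <= 1 - x by rewrite ge_min lexx orbT.
    exists (x + Num.min d (1 - x) / 2); split; [lra|lra|].
    apply: Hd; first by rewrite subrr normr0.
    by rewrite addrAC subrr add0r ger0_norm; lra.
  have A1 : has_ubound A by exists 1 => z [_ /ltW].
  have hA : has_sup A by split.
  have xs : x < sup A.
    have [z0 Az0] := A0; have [xz0 _ _] := Az0.
    by apply: lt_le_trans xz0 _; exact: ub_le_sup.
  (* any point above the middle of [x] and [sup A] is a good choice *)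
  have e0 : 0 < (sup A - x) / 2 by rewrite divr_gt0// subr_gt0.
  have [y [xy y1 Pxy] sy] := sup_adherent e0 hA.
  exists y => _; split=> // z xz z1 Pxz.
  have : z <= sup A by exact: ub_le_sup.
  lra.
have [f Hf] := choice step.
pose t k := iter k f 2^-1.
have t01 k : 0 < t k < 1.
  elim: k => [|k IH]; first by rewrite /t/=; apply/andP; split; lra.
  have [/= h1 h2 _ _] := Hf _ IH; move: IH => /andP[h3 _].
  by rewrite h2 andbT (lt_trans h3 h1).
have tlt k : t k < t k.+1 by have [] := Hf _ (t01 k).
have tP k : P (t k) (t k.+1) by have [] := Hf _ (t01 k).
have tS k z : t k < z -> z < 1 -> P (t k) z -> z - t k <= 2 * (t k.+1 - t k).
  by have [_ _ _] := Hf _ (t01 k); apply.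
exists t; split=> //.
have tnd : nondecreasing_seq t.
  by apply/nondecreasing_seqP => k; exact: ltW.
have tub : has_ubound (range t).
  by exists 1 => _ [k _ <-]; have /andP[_ /ltW] := t01 k.
have tcv := nondecreasing_cvgn tnd tub.
set c := sup (range t) in tcv.
have tc k : t k <= c by apply: ub_le_sup => //; exists k.
suff -> : 1 = c by [].
have c1 : c <= 1.
  apply: ge_sup; first by exists (t 0%N), 0%N.
  by move=> _ [k _ <-]; have /andP[_ /ltW] := t01 k.
apply/eqP; rewrite eq_le c1 andbT leNgt; apply/negP => c_lt1.
have c0 : 0 < c by apply: lt_le_trans (tc 0%N); have /andP[] := t01 0%N.
have [d d0 Hd] := HP c (introT andP (conj c0 c_lt1)).
(* [c + e] is admissible from every [t k] close enough to [c] *)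
pose e := Num.min d (1 - c) / 2.
have m0 : 0 < Num.min d (1 - c) by rewrite lt_min d0 subr_gt0.
have md : Num.min d (1 - c) <= d by rewrite ge_min lexx.
have m1 : Num.min d (1 - c) <= 1 - c by rewrite ge_min lexx orbT.
have e0 : 0 < e by rewrite /e; lra.
have e40 : 0 < e / 4 by lra.
have /cvgrPdist_lt/(_ _ e40)[k _ /(_ k (leqnn k))] := tcv.
rewrite ger0_norm ?subr_ge0// => ck.
have ec : c + e < 1 by rewrite /e; lra.
have tk : t k < c + e by have := tc k; lra.
have := tS k (c + e) tk ec.
have : P (t k) (c + e).
  apply: Hd.
    by rewrite distrC ger0_norm ?subr_ge0//; move: ck m0; rewrite /e; lra.
  by rewrite addrAC subrr add0r ger0_norm /e; lra.
move=> H /(_ H); have := tc k.+1; lra.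
Qed.

End greedy_subdivision.

Section chains.
Context {R : realType} {n : nat}.
Implicit Types (U : set 'rV[R]_n) (g : R -> 'rV[R]_n) (a : nat -> 'rV[R]_n)
  (o p q x : 'rV[R]_n) (l : R).

(** Polygonal paths in [U], starting at [o], with countably many edges that
    accumulate at the end point [p], which may be on the boundary. *)
Definition chain U a o p l := [/\ a 0%N = o,
  forall k (t : R), 0 <= t <= 1 -> U (a k + t *: (a k.+1 - a k)),
  a @ \oo --> p &
  forall N, \sum_(k < N) enorm (a k.+1 - a k) <= l].

Lemma chain_in U a o p l k : chain U a o p l -> U (a k).
Proof.
by move=> [_ /(_ k 0) + _ _]; rewrite scale0r addr0 lexx ler01; apply.
Qed.

Lemma ball_segment o (r : R) x y (t : R) : ball o r x -> ball o r y ->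
  0 <= t <= 1 -> ball o r (x + t *: (y - x)).
Proof.
rewrite -!ball_normE/= => ox oy /andP[t0 t1].
have -> : o - (x + t *: (y - x)) = (1 - t) *: (o - x) + t *: (o - y).
  by apply/rowP => i; rewrite !mxE; ring.
have t1' : 0 <= 1 - t by rewrite subr_ge0.
apply: le_lt_trans (ler_normD _ _) _; rewrite !normrZ (ger0_norm t0) (ger0_norm t1').
have := ler_wpM2l t1' (ltW ox); have := ler_wpM2l t0 (ltW oy).
have [t12|t12] := leP t 2^-1.
  have : (1 - t) * `|o - x| < (1 - t) * r by rewrite ltr_pM2l//; lra.
  lra.
have : t * `|o - y| < t * r by rewrite ltr_pM2l//; lra.
lra.
Qed.

(** An admissible step of the subdivision is one whose chord lies in [U]; near
    an interior parameter all chords are in a ball contained in [U]. *)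
Lemma curve_chain U g l : open U ->
  (forall t : R, 0 < t < 1 -> {for t, continuous g}) -> g @ 1^'- --> g 1 ->
  (forall t : R, 0 < t < 1 -> U (g t)) -> chord_bound g l ->
  exists a, chain U a (g 2^-1) (g 1) l.
Proof.
move=> oU cg cg1 Ug gl.
pose P (t s : R) := forall r : R, 0 <= r <= 1 -> U (g t + r *: (g s - g t)).
have [|t [t0 tlt t01 tP t1]] := @greedy_subdivision R P.
  move=> c c01.
  have /nbhs_ballP[r /= r0 rU] := oU _ (Ug c c01).
  have /nbhs_ballP[d /= d0 Hd] := cg c c01 _ (nbhsx_ballx (g c) _ r0).
  exists d => // t s tc sc w w01; apply: rU; apply: ball_segment => //.
    by apply: Hd; rewrite -ball_normE/= distrC.
  by apply: Hd; rewrite -ball_normE/= distrC.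
exists (g \o t); split=> /=.
- by rewrite t0.
- by move=> k r r01; exact: tP.
- apply: cvg_comp cg1 => A /= [d d0 dA].
  have /cvgrPdist_lt/(_ _ d0) := t1; apply: filterS => k.
  by move=> kd; apply: dA => //=; have /andP[] := t01 k.
- move=> N; apply: gl => //; first by have /andP[] := t01 0%N.
  by have /andP[] := t01 N.
Qed.

(** The curve is cut in the middle, and each half is run through towards its
    end point. *)
Lemma quasiconvex_chains U : open U -> locally_uniformly_quasiconvex U ->
  exists C d : R, [/\ 0 <= C, 0 < d &
  forall p q, closure U p -> closure U q -> p <> q -> enorm (p - q) < d ->
  exists o, (exists a, chain U a o p (C * enorm (p - q))) /\
            (exists b, chain U b o q (C * enorm (p - q)))].
Proof.
move=> oU [e [d [e0 d0 H]]]; exists e^-1, d; split=> //.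
  by rewrite invr_ge0 ltW.
move=> p q Up Uq pq dpq; have [g [cg g0 g1 Ug lg]] := H p q Up Uq pq dpq.
have gl := curve_length_chord_bound lg.
have [cg' cgl cgr] := (continuous_within_itvP g (@ltr01 R)).1 cg.
exists (g 2^-1); split.
  have [||||a] := @curve_chain U (fun t => g (1 - t)) (e^-1 * enorm (p - q)) oU.
  - move=> t /andP[t0 t1].
    apply: (@continuous_comp _ _ _ (fun t : R => 1 - t) g).
      by apply: cvgB; [exact: cvg_cst|exact: cvg_id].
    by apply: cg'; rewrite in_itv/= subr_gt0 t1 gtrBl.
  - rewrite subrr; apply: cvg_comp cgl => A [r /= r0 rA].
    exists r => // t; rewrite /ball_/= => tr t1; apply: rA.
      by rewrite /ball_/= sub0r normrN.
    by rewrite subr_gt0.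
  - by move=> t /andP[t0 t1]; apply: Ug; rewrite subr_gt0 t1/= gtrBl.
  - exact: chord_bound_rev.
  - by rewrite subrr g0 (_ : 1 - 2^-1 = 2^-1); [exists a|lra].
have [||//|//|a] := @curve_chain U g (e^-1 * enorm (p - q)) oU.
- by move=> t t01; apply: cg'; rewrite in_itv.
- by rewrite g1 in cgr *.
- by rewrite g1; exists a.
Qed.

End chains.

(** * Boundary values of C^1 functions *)

Section boundary_values.
Context {R : realType} {n : nat} (U : set 'rV[R]_n).
Hypothesis U_open : open U.
Implicit Types (phi : 'rV[R]_n -> R) (a : nat -> 'rV[R]_n)
  (o p q x : 'rV[R]_n) (l M : R).

Lemma flux_chain_prefix (Lambda : set 'rV[R]_n) a o p l K : chain U a o p l ->
  flux U Lambda (fun phi => phi (a K) - phi o) (n%:R * l).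
Proof.
move=> [a0 aU ap al].
have fk k : flux U Lambda (fun phi => phi (a k.+1) - phi (a k))
    (n%:R * enorm (a k.+1 - a k)) by apply: flux_segment => //; exact: aU.
have := flux_sum U_open (index_enum 'I_K) (fun k : 'I_K => fk k).
move/(flux_le _) => /(_ (n%:R * l)) fl; apply: flux_ext (fl _).
  move=> phi _; rewrite -(big_mkord xpredT (fun k => phi (a k.+1) - phi (a k))).
  by rewrite telescope_sumr// a0.
by rewrite -mulr_sumr ler_wpM2l ?al.
Qed.

(** The mean value inequality along the edges of the chain. *)
Lemma chain_bound a o p l K phi M : chain U a o p l -> C1b U phi ->
  (forall i x, U x -> `|jet phi i x| <= M) -> 0 <= M ->
  `|phi (a K) - phi o| <= M * (n%:R * l).
Proof.
move=> ch Cphi HM M0.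
exact: (flux_bound U_open (flux_chain_prefix set0 K ch) Cphi HM M0).
Qed.

Lemma chain_bound_lim a o p l phi M (v : R) : chain U a o p l -> C1b U phi ->
  (forall i x, U x -> `|jet phi i x| <= M) -> 0 <= M ->
  phi \o a @ \oo --> v -> `|v - phi o| <= M * (n%:R * l).
Proof.
move=> ch Cphi HM M0 av.
have h : (fun k => `|phi (a k) - phi o|) @ \oo --> `|v - phi o|.
  by apply: cvg_norm; apply: cvgB; [exact: av|exact: cvg_cst].
apply: (cvgr_to_le h); apply: nearW => K.
exact: (chain_bound K ch Cphi HM M0).
Qed.

Lemma chain_closure a o p l : chain U a o p l -> closure U p.
Proof.
move=> ch A Ap; have [_ _ ap _] := ch.
have [k _ /(_ k (leqnn k)) Aak] := ap _ Ap.
by exists (a k); split=> //; exact: (chain_in k ch).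
Qed.

Lemma chain_within a o p l : chain U a o p l -> a @ \oo --> within U (nbhs p).
Proof.
move=> ch A; rewrite /within/= => WA; have [_ _ ap _] := ch.
have : \forall k \near \oo, U (a k) -> A (a k) := ap _ WA.
by apply: filterS => k; apply; exact: (chain_in k ch).
Qed.

(** The value at [x] of the continuous extension of [phi] to the closure. *)
Definition bdval phi x : R := lim (phi @ within U (nbhs x)).

Lemma within_closure_proper x : closure U x -> ProperFilter (within U (nbhs x)).
Proof.
move=> Ux; apply: Build_ProperFilter_ex => A /Ux[y [Uy /(_ Uy) Ay]].
by exists y.
Qed.

Lemma bdval_in phi x : C1b U phi -> U x ->
  phi @ within U (nbhs x) --> phi x.
Proof.
move=> Cphi Ux; apply: cvg_comp (cvg_within U) _.
exact: (@jet_continuous _ _ U phi None x Cphi Ux).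
Qed.

Hypothesis U_qc : locally_uniformly_quasiconvex U.

Lemma C1b_jet_bound phi : C1b U phi ->
  exists2 M, 0 <= M & forall i x, U x -> `|jet phi i x| <= M.
Proof.
move=> /jet_bounded[M HM]; exists `|M| => // i x Ux.
by apply: le_trans (ler_norm M); exact: HM.
Qed.

(** The mean value inequality along the two chains which join a common point to
    [x] and to [y]. *)
Lemma C1b_locally_lipschitz phi : C1b U phi -> exists K d : R,
  [/\ 0 <= K, 0 < d & forall x y, U x -> U y -> enorm (x - y) < d ->
    `|phi x - phi y| <= K * enorm (x - y)].
Proof.
have [C [d [C0 d0 H]]] := quasiconvex_chains U_open U_qc.
move=> Cphi; have [M M0 HM] := C1b_jet_bound Cphi.
exists (2 * M * n%:R * C), d; split=> // [|x y Ux Uy xyd].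
  by rewrite !mulr_ge0.
have [->|/eqP xy] := eqVneq x y.
  by rewrite subrr normr0 mulr_ge0 ?enorm_ge0// !mulr_ge0.
have [w [[a ha] [b hb]]] :=
  H x y (subset_closure Ux) (subset_closure Uy) xy xyd.
have key z c : U z -> chain U c w z (C * enorm (x - y)) ->
    `|phi z - phi w| <= M * (n%:R * (C * enorm (x - y))).
  move=> Uz ch; apply: (chain_bound_lim ch Cphi HM M0).
  have [_ _ cz _] := ch.
  by apply: continuous_cvg cz; exact: (@jet_continuous _ _ U phi None z Cphi Uz).
rewrite (le_trans (ler_distD (phi w) _ _))//.
rewrite [leRHS](_ : _ = M * (n%:R * (C * enorm (x - y))) +
    M * (n%:R * (C * enorm (x - y)))); last by ring.
by rewrite (distrC (phi w)); exact: lerD (key x a Ux ha) (key y b Uy hb).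
Qed.

(** The local Lipschitz estimate in [U] is a Cauchy condition. *)
Lemma bdval_cvg phi x : C1b U phi -> closure U x ->
  phi @ within U (nbhs x) --> bdval phi x.
Proof.
move=> Cphi Ux; have PF := within_closure_proper Ux.
apply/cauchy_cvgP; apply: cauchy_exP => e e0.
have [K [d [K0 d0 HK]]] := C1b_locally_lipschitz Cphi.
(* two points of the sup-norm ball of radius [r] around [x] are at Euclidean
   distance at most [2 n r] *)
pose r := Num.min d (e / (K + 1)) / (2 * n.+1%:R).
have K10 : 0 < K + 1 by rewrite ltr_wpDl.
have m0 : 0 < Num.min d (e / (K + 1)) by rewrite lt_min d0 divr_gt0.
have r0 : 0 < r by rewrite divr_gt0// mulr_gt0.
have [u [Uu ux]] := Ux _ (nbhsx_ballx x _ r0).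
exists (phi u); rewrite /within/=.
have := nbhsx_ballx x _ r0; apply: filterS => y xy Uy /=.
have uy : enorm (u - y) < Num.min d (e / (K + 1)).
  apply: le_lt_trans (enorm_le_norm _) _.
  have : `|u - y| < 2 * r.
    move: ux xy; rewrite -!ball_normE/= => ux xy.
    by have := ler_distD x u y; rewrite (distrC u x); lra.
  have n0 : 0 < n.+1%:R :> R by [].
  have -> : 2 * r = Num.min d (e / (K + 1)) / n.+1%:R.
    by rewrite /r invfM; field.
  rewrite ltr_pdivlMr// => h; apply: le_lt_trans h.
  by rewrite mulrC ler_wpM2l// ler_nat.
move: uy; rewrite lt_min => /andP[uyd uye].
rewrite -ball_normE/=; apply: le_lt_trans (HK u y Uu Uy uyd) _.
apply: (@le_lt_trans _ _ ((K + 1) * enorm (u - y))).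
  by rewrite ler_wpM2r ?enorm_ge0// lerDl.
by rewrite -ltr_pdivlMl// mulrC.
Qed.

Lemma bdvalE phi x : C1b U phi -> U x -> bdval phi x = phi x.
Proof.
move=> Cphi Ux; have := within_closure_proper (subset_closure Ux) => PF.
apply: cvg_lim => //; exact: bdval_in.
Qed.

Lemma bdval_le phi x M : C1b U phi -> closure U x ->
  (forall y, U y -> `|phi y| <= M) -> `|bdval phi x| <= M.
Proof.
move=> Cphi Ux phiM; have PF := within_closure_proper Ux.
have h : (fun y => `|phi y|) @ within U (nbhs x) --> `|bdval phi x|.
  by apply: cvg_norm; exact: bdval_cvg.
apply: (cvgr_to_le h).
have := nbhsx_ballx x _ (@ltr01 R); apply: filterS => y _ Uy.
exact: phiM.
Qed.

Lemma chain_bdval a o p l phi : C1b U phi -> chain U a o p l ->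
  phi \o a @ \oo --> bdval phi p.
Proof.
move=> Cphi ch; apply: cvg_comp (chain_within ch) _.
exact: bdval_cvg Cphi (chain_closure ch).
Qed.

(** Chains give the estimate for points at distance less than [d]; for the
    others, the bound of [phi] does. *)
Lemma bdval_lipschitz phi : C1b U phi -> exists2 K : R, 0 <= K &
  forall x y, closure U x -> closure U y ->
    `|bdval phi x - bdval phi y| <= K * enorm (x - y).
Proof.
have [C [d [C0 d0 H]]] := quasiconvex_chains U_open U_qc.
move=> Cphi; have [M M0 HM] := C1b_jet_bound Cphi.
have K10 : 0 <= 2 * M * n%:R * C by rewrite !mulr_ge0.
have K20 : 0 <= 2 * M / d by rewrite divr_ge0 ?mulr_ge0// ltW.
exists (2 * M * n%:R * C + 2 * M / d) => [|x y Ux Uy]; first exact: addr_ge0.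
have [->|/eqP xy] := eqVneq x y.
  by rewrite subrr normr0 mulr_ge0 ?enorm_ge0// addr_ge0.
rewrite mulrDl; have [xyd|xyd] := ltP (enorm (x - y)) d.
  apply: ler_wpDr; first by rewrite mulr_ge0 ?enorm_ge0.
  have [w [[a ha] [b hb]]] := H x y Ux Uy xy xyd.
  have ba := chain_bound_lim ha Cphi HM M0 (chain_bdval Cphi ha).
  have bb := chain_bound_lim hb Cphi HM M0 (chain_bdval Cphi hb).
  rewrite (le_trans (ler_distD (phi w) _ _))//.
  rewrite [leRHS](_ : _ = M * (n%:R * (C * enorm (x - y))) +
      M * (n%:R * (C * enorm (x - y)))); last by ring.
  by rewrite (distrC (phi w)); exact: lerD ba bb.
apply: ler_wpDl; first by rewrite mulr_ge0 ?enorm_ge0.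
apply: le_trans (_ : 2 * M <= _).
  rewrite mulrDl mul1r (le_trans (ler_normB _ _))// lerD//.
    exact: bdval_le Cphi Ux (HM None).
  exact: bdval_le Cphi Uy (HM None).
have h1 : 1 <= d^-1 * enorm (x - y) by rewrite ler_pdivlMl// mulr1.
by rewrite -[leRHS]mulrA; apply: ler_peMr h1; rewrite mulr_ge0.
Qed.

(** The evaluations telescope along the edges, and converge at the end point. *)
Lemma flux_chain (Lambda : set 'rV[R]_n) a o p l : chain U a o p l ->
  flux U Lambda (fun phi => bdval phi p - phi o) (n%:R * l).
Proof.
move=> ch; have [a0 aU ap al] := ch.
apply: (@flux_series _ _ U Lambda U_open
  (fun k phi => phi (a k.+1) - phi (a k))
  (fun k => n%:R * enorm (a k.+1 - a k))).
- by move=> k; apply: flux_segment => //; exact: aU.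
- by move=> K; rewrite -mulr_sumr ler_wpM2l ?al.
- move=> phi Cphi; have := chain_bdval Cphi ch => av.
  rewrite (_ : (fun K => _) = fun K => phi (a K) - phi o).
    by apply: cvgB; [exact: av|exact: cvg_cst].
  apply/funext => K.
  rewrite -(big_mkord xpredT (fun k => phi (a k.+1) - phi (a k))).
  by rewrite telescope_sumr// a0.
Qed.

Lemma flux_bdval_diff : exists C d : R, [/\ 0 <= C, 0 < d &
  forall (Lambda : set 'rV[R]_n) p q, closure U p -> closure U q -> enorm (p - q) < d ->
    flux U Lambda (fun phi => bdval phi p - bdval phi q) (C * enorm (p - q))].
Proof.
have [C [d [C0 d0 H]]] := quasiconvex_chains U_open U_qc.
exists (2 * n%:R * C), d; split=> // [|Lambda p q Up Uq pqd]; first by rewrite !mulr_ge0.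
have [->|/eqP pq] := eqVneq p q.
  rewrite subrr enorm0 mulr0; apply: flux_ext (flux0 _ _) => phi _.
  by rewrite subrr.
have [w [[a ha] [b hb]]] := H p q Up Uq pq pqd.
have := fluxD U_open (flux_chain Lambda ha)
  (fluxN (flux_chain Lambda hb)).
move/(flux_le _) => /(_ (2 * n%:R * C * enorm (p - q))) fl.
apply: flux_ext (fl _); last by lra.
by move=> phi _; rewrite opprB addrA subrK.
Qed.

End boundary_values.

(** * From pairs of measures to divergence-measure fields *)

Section charges_from_measures.
Context d (T : measurableType d) (R : realType).
Implicit Types (P N mu : {measure set T -> \bar R}) (nu : {charge set T -> \bar R})
  (A : set T) (f : T -> R).

(** Carries the finiteness proof, so that the finite measure can be inferred. *)
Definition as_finite_measure mu (_ : fin_num_fun mu) : set T -> \bar R := mu.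

Section as_finite_measure.
Variables (mu : {measure set T -> \bar R}) (h : fin_num_fun mu).
HB.instance Definition _ := Measure.on (as_finite_measure h).
HB.instance Definition _ :=
  @Measure_isFinite.Build _ T R (as_finite_measure h) h.
End as_finite_measure.

Lemma charge_sub_exists P N : (P setT < +oo)%E -> (N setT < +oo)%E ->
  exists nu, forall A, nu A = (P A - N A)%E.
Proof.
move=> PT' NT'.
have PT : fin_num_fun P by move=> A mA; exact: finite_measure_le.
have NT : fin_num_fun N by move=> A mA; exact: finite_measure_le.
pose cP : {charge set T -> \bar R} :=
  charge_of_finite_measure (as_finite_measure PT).
pose cN : {charge set T -> \bar R} :=
  charge_of_finite_measure (as_finite_measure NT).
by exists (cadd cP (copp cN)).
Qed.

(** Any decomposition of a charge as a difference of two finite measures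
    dominates the Jordan decomposition and computes the same integrals. *)
Section jordan.
Variables (nu : {charge set T -> \bar R}) (P N : {measure set T -> \bar R}).
Hypotheses (PT : (P setT < +oo)%E) (NT : (N setT < +oo)%E).
Hypothesis nuE : forall A, measurable A -> nu A = (P A - N A)%E.

Let pos := jordan_pos (hahn_setsP nu).
Let neg := jordan_neg (hahn_setsP nu).

Lemma jordan_pos_le A : measurable A -> (pos A <= P A)%E.
Proof.
have [[mP _] _ _ _] := hahn_setsP nu => mA.
rewrite /pos jordan_posE cjordan_posE /crestr0 mem_set// /crestr.
have mAP : measurable (A `&` (hahn_sets nu).1) by exact: measurableI.
rewrite nuE//; apply: (@le_trans _ _ (P (A `&` (hahn_sets nu).1))).
  by rewrite leeBlDr ?finite_measure_le// leeDl.
by apply: le_measure; rewrite ?inE.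
Qed.

Lemma jordan_neg_le A : measurable A -> (neg A <= N A)%E.
Proof.
have [_ [mN _] _ _] := hahn_setsP nu => mA.
rewrite /neg jordan_negE cjordan_negE /crestr0 mem_set// /crestr.
have mAN : measurable (A `&` (hahn_sets nu).2) by exact: measurableI.
rewrite nuE//; apply: (@le_trans _ _ (N (A `&` (hahn_sets nu).2))).
  rewrite fin_num_oppeB ?finite_measure_le// addeC leeBlDr ?finite_measure_le//.
  by rewrite leeDl.
by apply: le_measure; rewrite ?inE.
Qed.

Lemma charge_abs_le A : measurable A -> (charge_abs nu A <= P A + N A)%E.
Proof. by move=> mA; apply: leeD; [exact: jordan_pos_le|exact: jordan_neg_le]. Qed.

Lemma abs_charge_le A : measurable A -> `|fine (nu A)| <= fine (P A + N A)%E.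
Proof.
move=> mA; have fP := finite_measure_le mA PT; have fN := finite_measure_le mA NT.
rewrite nuE// fineB// fineD// (le_trans (ler_normB _ _))//.
by rewrite !ger0_norm// fine_ge0.
Qed.

(** From [pos - neg = P - N], the measures [pos + N] and [neg + P] are equal. *)
Lemma charge_Rintegral_sub D f (M : R) : measurable D -> measurable_fun D f ->
  (forall x, D x -> `|f x| <= M) ->
  charge_Rintegral nu D f = \int[P]_(x in D) f x - \int[N]_(x in D) f x.
Proof.
move=> mD mf fM.
have posT : (pos setT < +oo)%E by apply: le_lt_trans PT; exact: jordan_pos_le.
have negT : (neg setT < +oo)%E by apply: le_lt_trans NT; exact: jordan_neg_le.
have ip := bounded_integrable mD posT mf fM.
have im := bounded_integrable mD negT mf fM.
have iP := bounded_integrable mD PT mf fM.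
have iN := bounded_integrable mD NT mf fM.
have mf' : measurable_fun D (EFin \o f) by exact/measurable_EFinP.
have : (\int[measure_add pos N]_(x in D) (f x)%:E =
    \int[measure_add neg P]_(x in D) (f x)%:E)%E.
  apply: eq_measure_integral => A mA _.
  transitivity (pos A + N A)%E; first exact: measure_addE.
  transitivity (neg A + P A)%E; last exact/esym/measure_addE.
  have e : nu A = (pos A - neg A)%E.
    by rewrite (jordan_decomp (hahn_setsP nu) mA) /cadd/= cscaleN1.
  have fpos : pos A \is a fin_num := finite_measure_le mA posT.
  have fneg : neg A \is a fin_num := finite_measure_le mA negT.
  have fP := finite_measure_le mA PT; have fN := finite_measure_le mA NT.
  move: e; rewrite nuE// -(fineK fP) -(fineK fN) -(fineK fpos) -(fineK fneg).
  by rewrite -!EFinB -!EFinD => -[e]; congr EFin; lra.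
rewrite !integral_measure_add//.
rewrite /charge_Rintegral /Rintegral -/pos -/neg.
have fp : (\int[pos]_(x in D) (f x)%:E)%E \is a fin_num.
  exact: (integrable_fin_num mD ip).
have fm : (\int[neg]_(x in D) (f x)%:E)%E \is a fin_num.
  exact: (integrable_fin_num mD im).
have fP : (\int[P]_(x in D) (f x)%:E)%E \is a fin_num.
  exact: (integrable_fin_num mD iP).
have fN : (\int[N]_(x in D) (f x)%:E)%E \is a fin_num.
  exact: (integrable_fin_num mD iN).
rewrite -(fineK fp) -(fineK fm) -(fineK fP) -(fineK fN).
by rewrite -!EFinD => -[e] /=; lra.
Qed.

End jordan.

End charges_from_measures.

Lemma big_option (V : nmodType) (I : finType) (F : option I -> V) :
  \sum_o F o = F None + \sum_i F (Some i).
Proof.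
rewrite (bigD1 None)//=; congr (_ + _).
rewrite (reindex_omap Some id) => [|[i|]//].
by apply: eq_bigl => i; rewrite /= eqxx.
Qed.

Lemma measure_sum_exists d (T : measurableType d) (R : realType) (I : Type)
    (s : seq I) (Q : I -> {measure set T -> \bar R}) :
  exists S : {measure set T -> \bar R},
    forall A, S A = (\sum_(i <- s) Q i A)%E.
Proof.
elim: s => [|i s [S HS]]; first by exists mzero => A; rewrite big_nil.
exists (measure_add (Q i) S) => A.
by rewrite big_cons -HS; exact: measure_addE.
Qed.

Section flux_to_field.
Context {R : realType} {n : nat} (U Lambda : set 'rV[R]_n).
Hypothesis U_open : open U.
Hypothesis Lambda_closed : closed Lambda.
Local Notation T := (borel R n).
Local Notation mT := {measure set T -> \bar R}.
Implicit Types (ell : ('rV[R]_n -> R) -> R) (c : R) (phi : 'rV[R]_n -> R).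

Lemma flux_integralE (Q : bool * option 'I_n -> mT) phi :
  flux_integral U Q phi =
  (\int[Q (false, None)]_(x in U) phi x - \int[Q (true, None)]_(x in U) phi x) +
  \sum_i (\int[Q (false, Some i)]_(x in U) partial i phi x -
          \int[Q (true, Some i)]_(x in U) partial i phi x).
Proof.
transitivity (\sum_(b : bool) \sum_(o : option 'I_n)
    (-1) ^+ b * \int[Q (b, o)]_(x in U) jet phi o x).
  by rewrite pair_bigA; apply: eq_bigr => -[b o].
rewrite big_bool/= !big_option/= addrC !expr0 expr1 !mul1r !mulN1r.
rewrite addrACA -big_split/=; congr (_ + _).
by apply: eq_bigr => i _; rewrite mul1r mulN1r.
Qed.

Lemma vector_charge_abs_le (F : vector_charge T R n) (mu : mT) (A : set T) :
  measurable A -> (mu setT < +oo)%E ->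
  (forall i B, measurable B -> `|fine (F i B)| <= fine (mu B)) ->
  (vector_charge_abs F A <= n%:R%:E * mu A)%E.
Proof.
move=> mA muT Fmu; apply: ge_ereal_sup => _ [E [mE tE EA] <-].
apply: (@le_trans _ _ (\sum_(0 <= k <oo) (n%:R%:E * mu (E k)))%E).
  apply: lee_nneseries => [k _ _|k _]; first by rewrite lee_fin enorm_ge0.
  rewrite -(fineK (finite_measure_le (mE k) muT)) -EFinM lee_fin.
  apply: le_trans (enorm_le_sum _) _.
  rewrite -[n in n%:R](card_ord n) mulr_natl -sumr_const.
  by apply: ler_sum => i _; rewrite mxE; exact: Fmu.
rewrite nneseriesZl//; apply: lee_wpmul2l; first by rewrite lee_fin.
by rewrite -EA measure_semi_bigcup// EA.
Qed.

(** The components of the field are the charges [Q (true, o) - Q (false, o)].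
    The functional vanishes on test functions, which is the divergence
    identity.  The sum [S] of all the measures dominates each component. *)
Lemma flux_field ell c : flux U Lambda ell c ->
  (forall phi, test_function U phi -> C1b U phi /\ ell phi = 0) ->
  exists F : DMext U,
  [/\ forall phi, C1b U phi -> ell phi =
        - vector_charge_integral F U (grad phi)
        - charge_Rintegral (dm_div F) U phi,
      charge_abs (dm_div F) (U `\` Lambda) = 0%E &
      (DMext_norm F <= ((n%:R + 1) * c)%:E)%E].
Proof.
move=> [Q [QU QL Qc HQ]] ell0.
have QT j := flux_lty j Qc.
have mU := open_borel U_open.
have [S SE] := measure_sum_exists (index_enum (bool * option 'I_n)%type) Q.
have ST : (S setT < +oo)%E by rewrite SE (le_lt_trans Qc)// ltry.
have QS A o : measurable A -> (Q (true, o) A + Q (false, o) A <= S A)%E.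
  rewrite SE (bigD1 (true, o))//= leeD2l// (bigD1 (false, o))//= leeDl//.
  by rewrite sume_ge0.
pose G o := charge_sub_exists (QT (true, o)) (QT (false, o)).
have [F HF] := choice G.
have nuU o (B : set T) : measurable B -> B `&` U = set0 -> F o B = 0%E.
  move=> mB BU; rewrite HF.
  have BQ j : Q j B = 0%E.
    apply/eqP; rewrite eq_le measure_ge0 andbT -(QU j); apply: le_measure.
    - by rewrite inE.
    - by rewrite inE; exact: measurableC.
    - by move=> x Bx Ux; have : (B `&` U) x by []; rewrite BU.
  by rewrite !BQ subee.
have FR o phi : C1b U phi -> charge_Rintegral (F o) U (jet phi o) =
    \int[Q (true, o)]_(x in U) jet phi o x - \int[Q (false, o)]_(x in U) jet phi o x.
  move=> Cphi; have [M HM] := jet_bounded Cphi.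
  apply: (@charge_Rintegral_sub _ _ _ _ _ _ _ _ _ _ _ M) => //.
  - exact: jet_measurable.
  - exact: HM.
have ellE phi : C1b U phi -> ell phi =
    - vector_charge_integral (fun i => F (Some i)) U (grad phi)
    - charge_Rintegral (F None) U phi.
  move=> Cphi; rewrite HQ// flux_integralE (FR None phi Cphi) opprB addrC.
  congr (_ + _); rewrite /vector_charge_integral -sumrN.
  apply: eq_bigr => i _.
  have -> : (fun x => grad phi x ord0 i) = jet phi (Some i).
    by apply/funext => x; rewrite mxE.
  by rewrite (FR (Some i) phi Cphi) opprB.
have divP phi : test_function U phi -> charge_Rintegral (F None) U phi =
    - vector_charge_integral (fun i => F (Some i)) U (grad phi).
  by move=> /ell0[Cphi]; rewrite ellE// => /eqP; rewrite subr_eq0 => /eqP.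
exists (@Build_DMext _ _ U (fun i => F (Some i)) (F None)
  (fun i => nuU (Some i)) (nuU None) divP); split => //=.
- apply/eqP; rewrite eq_le; apply/andP; split; last first.
    by rewrite /charge_abs /charge_variation adde_ge0.
  have mUL : measurable (U `\` Lambda : set T).
    by apply: measurableD => //; exact: closed_borel.
  apply: le_trans (charge_abs_le (QT _) (QT _) (fun A _ => HF None A) mUL) _.
  have z b : Q (b, None) (U `\` Lambda) = 0%E.
    apply/eqP; rewrite eq_le measure_ge0 andbT -(QL b); apply: le_measure.
    - by rewrite inE.
    - by rewrite inE; apply: measurableC; exact: closed_borel.
    - by move=> x [].
  by rewrite !z adde0.
- rewrite /DMext_norm/=.
  have SU : (S U <= c%:E)%E.
    apply: (@le_trans _ _ (S setT)); first by apply: le_measure; rewrite ?inE.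
    by rewrite SE.
  rewrite mulrDl mul1r EFinD; apply: leeD.
    apply: (@le_trans _ _ (n%:R%:E * S U)%E); last first.
      by rewrite EFinM lee_wpmul2l// lee_fin.
    apply: vector_charge_abs_le => // i B mB.
    apply: le_trans (abs_charge_le (QT _) (QT _) (fun A _ => HF (Some i) A) mB) _.
    rewrite fine_le//; last exact: QS.
      by rewrite fin_numD !finite_measure_le.
    exact: finite_measure_le.
  apply: le_trans (charge_abs_le (QT _) (QT _) (fun A _ => HF None A) mU) _.
  by apply: le_trans SU; exact: QS.
Qed.

End flux_to_field.

(** * Point evaluations on the boundary as fluxes *)

Section flux_boundary.
Context {R : realType} {n : nat} (U : set 'rV[R]_n).
Hypothesis U_open : open U.
Implicit Types (phi : 'rV[R]_n -> R) (x p q : 'rV[R]_n).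

Lemma boundary_open x : boundary U x <-> closure U x /\ ~ U x.
Proof. by rewrite /boundary (interior_id U).1. Qed.

Lemma bounded_of_support (K : set 'rV[R]_n) phi : continuous phi -> compact K ->
  (forall x, ~ K x -> phi x = 0) -> exists M : R, forall x, `|phi x| <= M.
Proof.
move=> cphi cK phi0.
have /compact_bounded[M [Mr HM]] : compact (phi @` K).
  by apply: continuous_compact => //; exact: continuous_subspaceT.
exists (`|M| + 1) => x; have [Kx|nKx] := pselect (K x).
  apply: (HM (`|M| + 1)); last by exists x.
  by rewrite (le_lt_trans (ler_norm M))// ltrDl.
by rewrite phi0// normr0 addr_ge0.
Qed.

Lemma test_function_C1b phi : test_function U phi -> C1b U phi.
Proof.
set K := closure [set x | phi x != 0] => -[sphi cK KU].
have d0 x : differentiable phi x := sphi [::] x.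
have d1 i x : differentiable (partial i phi) x := sphi [:: i] x.
have phi0 x : ~ K x -> phi x = 0.
  by move=> nKx; apply/eqP/negPn/negP => px; apply: nKx; exact: subset_closure.
have dphi0 i x : ~ K x -> partial i phi x = 0.
  move=> nKx; rewrite /partial (@near_eq_derive _ _ _ phi (cst 0)) ?derive_cst//.
  have oK : open (~` K) by apply: closed_openC; exact: closed_closure.
  by apply: filterS (oK x nKx) => y; exact: phi0.
split=> [x _|i x _||].
- exact: d0.
- exact: differentiable_continuous.
- have [|M HM] := bounded_of_support _ cK phi0.
    by move=> x; exact: differentiable_continuous.
  by exists M.
- have [|M HM] := choice (fun i => bounded_of_support _ cK (dphi0 i)).
    by move=> i x; exact: differentiable_continuous.
  exists (\sum_i M i) => x _; apply: le_trans (enorm_le_sum _) _.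
  by apply: ler_sum => i _; rewrite mxE.
Qed.

Lemma test_function_bdval phi x : test_function U phi -> boundary U x ->
  bdval U phi x = 0.
Proof.
set K := closure [set x | phi x != 0] => -[_ _ KU] /boundary_open[Ux nUx].
have PF := within_closure_proper Ux.
have nKx : (~` K) x by move=> /KU.
have oK : open (~` K) by apply: closed_openC; exact: closed_closure.
apply: cvg_lim => //; apply: (@cvg_trans _ (phi @ nbhs x)).
  exact: cvg_within_filter.
apply: cvg_near_cst; apply: filterS (oK x nKx) => y nKy.
by apply/eqP/negPn/negP => py; apply: nKy; exact: subset_closure.
Qed.

Hypothesis U_qc : locally_uniformly_quasiconvex U.

(** The scale [d] of quasiconvexity dictates the separation [r] of [Lambda]:
    every boundary point is at distance less than [d] from [Lambda].  Beyond
    distance [d], a difference of two evaluations is treated as two separate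
    evaluations, at a cost bounded by a multiple of the distance. *)
Lemma flux_boundary : exists (Lambda : set 'rV[R]_n) (c : R),
  [/\ Lambda `<=` U, discrete_set Lambda, closed Lambda & 0 < c] /\
  ((forall x, boundary U x -> flux U Lambda (fun phi => bdval U phi x) c) /\
   (forall x y, boundary U x -> boundary U y ->
      flux U Lambda (fun phi => bdval U phi x - bdval U phi y)
        (c * enorm (x - y)))).
Proof.
have [C [d [C0 d0 H]]] := flux_bdval_diff U_open U_qc.
have n0 : 0 < n.+1%:R :> R by [].
pose r := d / (2 * n.+1%:R).
have r0 : 0 < r by rewrite divr_gt0// mulr_gt0.
have [Lambda [LU sL cover]] := maximal_separated U r0.
have cL := separated_closed r0 sL.
pose c := C * d + 1.
have c0 : 0 < c by rewrite ltr_wpDl// mulr_ge0// ltW.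
have fx x : boundary U x -> flux U Lambda (fun phi => bdval U phi x) c.
  move=> /boundary_open[Ux _].
  have [u [Uu xu]] := Ux _ (nbhsx_ballx x _ r0).
  have [a La ua] := cover u Uu.
  have Ua := LU _ La.
  have xa : enorm (x - a) < d.
    apply: le_lt_trans (enorm_le_norm _) _.
    have : `|x - a| < 2 * r.
      by move: xu; rewrite -ball_normE/= => xu; have := ler_distD u x a; lra.
    have -> : 2 * r = d / n.+1%:R by rewrite /r invfM; field.
    rewrite ltr_pdivlMr// => h; apply: le_lt_trans h.
    by rewrite mulrC ler_wpM2l// ler_nat.
  have f1 := H Lambda x a Ux (subset_closure Ua) xa.
  have f2 := flux_point U_open Ua La.
  apply: flux_le (flux_ext _ (fluxD U_open f1 f2)).
    by rewrite lerD2r ler_wpM2l// ltW.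
  by move=> phi Cphi; rewrite (bdvalE Cphi Ua) subrK.
have cd0 : 0 <= 2 * c / d by rewrite divr_ge0 ?mulr_ge0// ltW.
exists Lambda, (C + c + 2 * c / d); split; last split.
- split=> //; first exact: separated_discrete sL.
  by rewrite ltr_wpDr// ltr_wpDl.
- move=> x bx; apply: flux_le (fx x bx).
  by rewrite -addrA (addrC c) addrA lerDr addr_ge0.
- move=> x y bx by_.
  have [Ux _] := (boundary_open x).1 bx; have [Uy _] := (boundary_open y).1 by_.
  have [xyd|xyd] := ltP (enorm (x - y)) d.
    apply: flux_le (H Lambda x y Ux Uy xyd).
    by rewrite ler_wpM2r ?enorm_ge0// -addrA lerDl addr_ge0// ltW.
  apply: flux_le (fluxD U_open (fx x bx) (fluxN (fx y by_))).
  rewrite mulrDl; apply: ler_wpDl.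
    by rewrite mulr_ge0 ?enorm_ge0// addr_ge0// ltW.
  have h1 : 1 <= d^-1 * enorm (x - y) by rewrite ler_pdivlMl// mulr1.
  rewrite -[leRHS]mulrA -[leLHS]mulr1.
  rewrite (_ : c + c = 2 * c); last by rewrite mulrDl mul1r.
  by rewrite ler_wpM2l// mulr_ge0// ltW.
Qed.

End flux_boundary.

(** * Dual norms on bounded Lipschitz functions *)

Section bounded_lipschitz_duality.
Context {R : realType} {n : nat} (X : set 'rV[R]_n).
Implicit Types (f : lipb X) (s : seq (R * X)) (m : arens_eells X) (A D e : R).

Lemma lipb_ext f (g : lipb X) : (forall x, f x = g x) -> f = g.
Proof. by move=> fg; apply: val_inj; apply/funext. Qed.

Lemma lipb_exists (h : X -> R) (M L : R) : (forall x, `|h x| <= M) ->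
  (forall x y, `|h x - h y| <= L * enorm (\val x - \val y)) ->
  exists f, forall x, f x = h x.
Proof.
move=> hM hL.
have hP : (h : X -> R^o) \in @lipb_pred R n X.
  by apply/asboolP; split; [exists M|exists L].
by exists (LipB hP).
Qed.

(** The norm of [f] is at most [A], without the suprema. *)
Definition lipb_le f A := (forall x, `|f x| <= A) /\
  (forall x y, `|f x - f y| <= A * enorm (\val x - \val y)).

Lemma lipb_le_exists f : exists2 A, 0 < A & lipb_le f A.
Proof.
case: f => f fP; have /asboolP[[M HM] [L HL]] := fP.
exists (`|M| + `|L| + 1); first by rewrite ltr_wpDl.
split=> [x|x y] /=.
  apply: le_trans (HM x) _; apply: le_trans (ler_norm M) _.
  by rewrite -addrA lerDl addr_ge0.
apply: le_trans (HL x y) _; rewrite ler_wpM2r ?enorm_ge0//.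
by apply: le_trans (ler_norm L) _; rewrite addrAC lerDr addr_ge0.
Qed.

Lemma sup_le_nonneg (E : set R) A : 0 <= A -> ubound E A -> sup E <= A.
Proof.
move=> A0 EA; have [E0|E0] := pselect (E !=set0); first exact: ge_sup.
by rewrite sup_out// => -[].
Qed.

Lemma lipb_norm_le f A : 0 <= A -> lipb_le f A -> lipb_norm f <= A.
Proof.
move=> A0 [fA fL]; rewrite /lipb_norm ge_max; apply/andP; split.
  by apply: sup_le_nonneg => // _ [x _ <-].
apply: sup_le_nonneg => // _ [x [y [xy ->]]].
have xy0 : 0 < enorm (\val x - \val y).
  rewrite lt_def enorm_ge0 andbT; apply/eqP => /enorm_eq0/eqP.
  by rewrite subr_eq0 => /eqP/val_inj.
by rewrite ler_pdivrMr.
Qed.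

Lemma dual_norm_le (m : lipb X -> R) D : (dual_norm m <= D%:E)%E ->
  forall f, lipb_norm f <= 1 -> `|m f| <= D.
Proof.
move=> mD f f1; rewrite -lee_fin; apply: le_trans mD.
by apply: ereal_sup_ubound; exists f.
Qed.

(** Homogeneity extends a bound on the unit ball to all functions; the maps in
    question are differences between an element of the Arens-Eells space and a
    finite combination. *)
Lemma dual_bound (m : lipb X -> R) D f A :
  (forall a f, m (a *: f) = a * m f) ->
  (forall f, lipb_norm f <= 1 -> `|m f| <= D) ->
  0 < A -> lipb_le f A -> `|m f| <= D * A.
Proof.
move=> mZ mD A0 [fA fL].
have /mD : lipb_norm (A^-1 *: f) <= 1.
  have Ai : 0 <= A^-1 by rewrite invr_ge0 ltW.
  apply: lipb_norm_le => //; split=> [x|x y].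
    rewrite [X in `|X|](_ : _ = A^-1 * f x)// normrM (ger0_norm Ai).
    by rewrite ler_pdivrMl// mulr1.
  rewrite [X in `|X|](_ : _ = A^-1 * (f x - f y)); last by rewrite mulrBr.
  by rewrite normrM (ger0_norm Ai) ler_pdivrMl// mul1r.
by rewrite mZ normrM gtr0_norm ?invr_gt0// ler_pdivrMl// mulrC.
Qed.

Lemma delta_combZ s a f : delta_comb s (a *: f) = a * delta_comb s f.
Proof. by rewrite /delta_comb mulr_sumr; apply: eq_bigr => ax _; rewrite mulrCA. Qed.

Lemma ae_approx m e : 0 < e ->
  exists s, forall f, lipb_norm f <= 1 -> `|m f - delta_comb s f| <= e.
Proof.
move=> e0; have [s ms] := ae_closure m e0.
exists s => f; exact: (dual_norm_le (ltW ms)).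
Qed.

Lemma ae_approxZ m s a f :
  m (a *: f) - delta_comb s (a *: f) = a * (m f - delta_comb s f).
Proof. by rewrite linearZ delta_combZ/= mulrBr. Qed.

End bounded_lipschitz_duality.

(** * Uniqueness of the normal trace *)

Lemma common_value_dist (R : realFieldType) (a a' b u v u' v' e : R) :
  `|a - u| <= e / 8 -> `|b - v| <= e / 8 ->
  `|a' - u'| <= e / 8 -> `|b - v'| <= e / 8 ->
  `|(u - v) - (u' - v')| <= e / 4 -> `|a' - a| <= e.
Proof.
rewrite !ler_norml => /andP[? ?] /andP[? ?] /andP[? ?] /andP[? ?] /andP[? ?].
by apply/andP; split; lra.
Qed.

Section normal_traces.
Context {R : realType} {n : nat} (U : set 'rV[R]_n).
Hypothesis U_open : open U.
Local Notation X := (boundary U).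
Implicit Types (f psi : lipb X) (s : seq (R * X)) (m : arens_eells X)
  (phi g : 'rV[R]_n -> R) (A D e : R).

Lemma C1_C1b g (M L : R) : C1 g -> (forall x, `|g x| <= M) -> 0 <= L ->
  (forall x y, `|g x - g y| <= L * enorm (x - y)) -> C1b U g.
Proof.
move=> [dg cg] gM L0 gL; split=> [x _|i x _||].
- exact: dg.
- exact: cg.
- by exists M.
- exists (\sum_(i < n) L) => x _; apply: le_trans (enorm_le_sum _) _.
  by apply: ler_sum => i _; rewrite mxE; exact: lipschitz_partial_le.
Qed.

Lemma boundary_value_unique phi psi psi' : boundary_value phi psi ->
  boundary_value phi psi' -> psi = psi'.
Proof.
move=> h h'; apply: lipb_ext => x.
have PF : ProperFilter (within U (nbhs (\val x))).
  apply: within_closure_proper.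
  by have /(boundary_open U_open)[] : X (\val x) := set_valP x.
exact: (cvg_unique (@Rhausdorff R) (h x) (h' x)).
Qed.

Lemma delta_comb_close s f (g : lipb X) e :
  (forall a x, (a, x) \in s -> `|f x - g x| <= e) ->
  `|delta_comb s f - delta_comb s g| <= (\sum_(ax <- s) `|ax.1|) * e.
Proof.
move=> fg; rewrite /delta_comb -sumrB mulr_suml.
apply: le_trans (ler_norm_sum _ _ _) _.
rewrite big_seq [leRHS]big_seq; apply: ler_sum => -[a x] ax.
by rewrite -mulrBr normrM ler_wpM2l//=; exact: fg ax.
Qed.

(** An element of the Arens-Eells space is close to a finite combination of
    point evaluations, and every Lipschitz function agrees at finitely many
    points, up to an arbitrarily small error, with a C^1 function having the
    same bound and the same Lipschitz constant. *)
Lemma normal_trace_unique (F : DMext U) m m' :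
  normal_trace_identity F m -> normal_trace_identity F m' -> m' =1 m.
Proof.
move=> Fm Fm' f; apply/eqP; rewrite -subr_eq0 -normr_le0.
apply/ler_addgt0Pl => e e0; rewrite addr0.
have [A A0 [fA fL]] := lipb_le_exists f.
pose e1 := e / (16 * A).
have e10 : 0 < e1 by rewrite divr_gt0 ?mulr_gt0.
have [s ms] := ae_approx m e10; have [s' ms'] := ae_approx m' e10.
pose S := \sum_(ax <- s) `|ax.1| + \sum_(ax <- s') `|ax.1|.
have S0 : 0 <= S by rewrite addr_ge0// sumr_ge0.
have S10 : 0 < S + 1 by rewrite ltr_wpDl.
(* [eta] is the accuracy needed at the points of [s] and [s'] *)
pose eta := Num.min A (e / (4 * (S + 1))).
have eta0 : 0 < eta by rewrite lt_min A0 divr_gt0// mulr_gt0.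
have etaA : eta <= A by rewrite ge_min lexx.
have etaS : S * eta <= e / 4.
  apply: (@le_trans _ _ ((S + 1) * (e / (4 * (S + 1))))).
    apply: ler_pM => //; first exact: ltW.
      by rewrite lerDl.
    by rewrite ge_min lexx orbT.
  by rewrite le_eqVlt; apply/orP; left; apply/eqP; field; rewrite gt_eqF.
have [||g [Cg gL gM gf]] := @smooth_lipschitz_extension R n
    [seq (\val ax.2, f ax.2) | ax <- s ++ s'] A A eta (ltW A0) (ltW A0) eta0.
- by move=> _ /mapP[ax _ ->] /=.
- move=> _ _ /mapP[ax _ ->] /mapP[bx _ ->] /=.
  have := fL ax.2 bx.2; rewrite ler_norml => /andP[_]; lra.
have {}gM x : `|g x| <= 2 * A by apply: le_trans (gM x) _; lra.
have Cb : C1b U g := C1_C1b Cg gM (ltW A0) gL.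
have [psi bpsi mpsi] := Fm g Cb; have [psi' bpsi' mpsi'] := Fm' g Cb.
have mm : m psi = m' psi.
  by rewrite mpsi -mpsi' (boundary_value_unique bpsi bpsi').
have psiE x : psi x = g (\val x).
  have PF : ProperFilter (within U (nbhs (\val x))).
    apply: within_closure_proper.
    by have /(boundary_open U_open)[] : X (\val x) := set_valP x.
  apply: (cvg_unique (@Rhausdorff R) (bpsi x)); apply: cvg_within_filter.
  by apply: differentiable_continuous; case: Cg.
have A20 : 0 < 2 * A by rewrite mulr_gt0.
have psiA : lipb_le psi (2 * A).
  split=> [x|x y]; rewrite !psiE//; apply: le_trans (gL _ _) _.
  by rewrite ler_wpM2r ?enorm_ge0// ler_peMl ?(ltW A0)// ler1n.
have fA2 : lipb_le f (2 * A).
  split=> [x|x y]; first by apply: le_trans (fA x) _; lra.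
  apply: le_trans (fL _ _) _.
  by rewrite ler_wpM2r ?enorm_ge0// ler_peMl ?(ltW A0)// ler1n.
have eA : e1 * (2 * A) = e / 8.
  by rewrite /e1; field; rewrite gt_eqF.
have h1 := dual_bound (ae_approxZ m s) ms A20 fA2.
have h2 := dual_bound (ae_approxZ m s) ms A20 psiA.
have h3 := dual_bound (ae_approxZ m' s') ms' A20 fA2.
have h4 := dual_bound (ae_approxZ m' s') ms' A20 psiA.
have gclose a x : (a, x) \in s ++ s' -> `|f x - psi x| <= eta.
  move=> ax; rewrite psiE distrC.
  by apply: (gf (\val x, f x)); apply/mapP; exists (a, x).
have h5 : `|delta_comb s f - delta_comb s psi| <= (\sum_(ax <- s) `|ax.1|) * eta.
  by apply: delta_comb_close => a x ax; apply: (gclose a); rewrite mem_cat ax.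
have h6 : `|delta_comb s' f - delta_comb s' psi| <= (\sum_(ax <- s') `|ax.1|) * eta.
  by apply: delta_comb_close => a x ax; apply: (gclose a); rewrite mem_cat ax orbT.
rewrite eA in h1 h2 h3 h4; rewrite mm in h2.
have h7 : `|(delta_comb s f - delta_comb s psi) -
    (delta_comb s' f - delta_comb s' psi)| <= e / 4.
  apply: le_trans (ler_normB _ _) _; apply: le_trans (lerD h5 h6) _.
  by rewrite -mulrDl.
exact: (common_value_dist h1 h2 h3 h4 h7).
Qed.

End normal_traces.

(** * Transport cost and duality *)

Section arens_eells_flux.
Context {R : realType} {n : nat} (U Lambda : set 'rV[R]_n) (c0 : R).
Hypothesis U_open : open U.
Hypothesis c0_gt0 : 0 < c0.
Local Notation X := (boundary U).
Hypothesis flux_bdval : forall x, X x -> flux U Lambda (fun phi => bdval U phi x) c0.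
Hypothesis flux_bdvalB : forall x y, X x -> X y ->
  flux U Lambda (fun phi => bdval U phi x - bdval U phi y) (c0 * enorm (x - y)).
Implicit Types (f : lipb X) (s : seq (R * X)) (D : R).

Section flux_cost.
Variables (k : nat) (x : 'I_k -> X).
Implicit Types v w : 'rV[R]_k.

Definition flux_comb v (phi : 'rV[R]_n -> R) :=
  \sum_i v ord0 i * bdval U phi (\val (x i)).

Definition flux_cost v := inf [set c | flux U Lambda (flux_comb v) c].

Lemma flux_cost_le v c : flux U Lambda (flux_comb v) c -> flux_cost v <= c.
Proof. by move=> vc; apply: ge_inf => //; exists 0 => d; exact: flux_ge0. Qed.

Lemma flux_cost_nonempty v : [set c | flux U Lambda (flux_comb v) c] !=set0.
Proof.
exists (\sum_i `|v ord0 i| * c0).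
apply: flux_sum => // i; apply: flux_scale => //; apply: flux_bdval.
exact: set_valP.
Qed.

Lemma flux_cost_sublinear : sublinear flux_cost.
Proof.
split=> [v w|t v].
  rewrite -lerBlDr; apply: lb_le_inf; first exact: flux_cost_nonempty.
  move=> c /= vc; rewrite lerBlDl -lerBlDr.
  apply: lb_le_inf; first exact: flux_cost_nonempty.
  move=> d /= wd; rewrite lerBlDr addrC; apply: flux_cost_le.
  apply: flux_ext (fluxD U_open wd vc) => phi _.
  by rewrite /flux_comb -big_split/=; apply: eq_bigr => i _; rewrite mxE mulrDl.
rewrite le_eqVlt => /predU1P[<-|t0].
  rewrite scale0r mul0r; apply: flux_cost_le; apply: flux_ext (flux0 _ _) => phi _.
  by rewrite /flux_comb big1// => i _; rewrite mxE mul0r.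
rewrite -ler_pdivrMl//; apply: lb_le_inf; first exact: flux_cost_nonempty.
move=> c /= vc; rewrite ler_pdivrMl//; apply: flux_cost_le.
have := flux_scale U_open t vc; rewrite (gtr0_norm t0).
apply: flux_ext => phi _; rewrite /flux_comb mulr_sumr.
by apply: eq_bigr => i _; rewrite mxE mulrA.
Qed.

End flux_cost.

(** A linear form [f] below the cost, equal to it at the given coefficients,
    consists of values at the points which are bounded by [c0] and
    [c0]-Lipschitz.  Extended to a function on the boundary, they bound the
    cost by a pairing with the given combination. *)
Lemma flux_delta_comb s D : 0 < D ->
  (forall f, lipb_norm f <= 1 -> `|delta_comb s f| <= D) ->
  flux U Lambda (fun phi => \sum_(ax <- s) ax.1 * bdval U phi (\val ax.2))
    (4 * c0 * D).
Proof.
move=> D0 sD; pose k := size s; pose x (i : 'I_k) := (tnth (in_tuple s) i).2.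
pose v0 : 'rV[R]_k := \row_i (tnth (in_tuple s) i).1.
have [f [fp pf]] := hahn_banach_rV v0 (flux_cost_sublinear x).
have dot v i (a : R) : \sum_j (a *: delta_mx ord0 i : 'rV[R]_k) ord0 j * v j = a * v i.
  rewrite (bigD1 i)//= !mxE !eqxx mulr1 big1 ?addr0// => j ji.
  by rewrite !mxE eqxx (negbTE ji) mulr0 mul0r.
have fle i : f i <= c0.
  have := fp (1 *: delta_mx ord0 i); rewrite dot mul1r => /le_trans; apply.
  apply: flux_cost_le; apply: flux_ext (flux_bdval (set_valP (x i))) => phi _.
  by rewrite /flux_comb (dot (fun j => bdval U phi (\val (x j)))) mul1r.
have fge i : - c0 <= f i.
  rewrite lerNl; have := fp (-1 *: delta_mx ord0 i).
  rewrite dot mulN1r => /le_trans; apply.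
  apply: flux_cost_le; apply: flux_ext (fluxN (flux_bdval (set_valP (x i)))) => phi _.
  by rewrite /flux_comb (dot (fun j => bdval U phi (\val (x j)))) mulN1r.
have fL i j : f i <= f j + c0 * enorm (\val (x i) - \val (x j)).
  rewrite -lerBlDl.
  have := fp (1 *: delta_mx ord0 i + (-1) *: delta_mx ord0 j).
  have sp (v : 'I_k -> R) : \sum_l (1 *: delta_mx ord0 i +
      (-1) *: delta_mx ord0 j : 'rV[R]_k) ord0 l * v l = v i - v j.
    rewrite -[v i]mul1r -[- v j]mulN1r -!dot -big_split/=.
    by apply: eq_bigr => l _; rewrite !mxE mulrDl.
  rewrite sp => /le_trans; apply; apply: flux_cost_le.
  apply: flux_ext (flux_bdvalB (set_valP (x i)) (set_valP (x j))) => phi _.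
  by rewrite /flux_comb (sp (fun l => bdval U phi (\val (x l)))).
pose S := \sum_i `|v0 ord0 i|.
have S0 : 0 <= S by rewrite sumr_ge0.
have S10 : 0 < S + 1 by rewrite ltr_wpDl.
(* [f] is only interpolated up to [eta], which costs [S * eta <= D] *)
pose eta := Num.min 1 (D / (S + 1)).
have eta0 : 0 < eta by rewrite lt_min ltr01 divr_gt0.
have etaS : S * eta <= D.
  apply: (@le_trans _ _ ((S + 1) * (D / (S + 1)))).
    apply: ler_pM => //; first exact: ltW.
      by rewrite lerDl.
    by rewrite ge_min lexx orbT.
  by rewrite mulrC divfK// gt_eqF.
have [||g [Cg gL gM gf]] := @smooth_lipschitz_extension R n
    [seq (\val (x i), f i / c0) | i <- enum 'I_k] 1 1 eta ler01 ler01 eta0.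
- move=> _ /mapP[i _ ->] /=.
  by rewrite ler_norml ler_pdivlMr// ler_pdivrMr// mulN1r mul1r fge fle.
- move=> _ _ /mapP[i _ ->] /mapP[j _ ->] /=.
  by rewrite mul1r ler_pdivrMr// mulrDl divfK ?gt_eqF// mulrC.
have {}gM y : `|g y| <= 2.
  by apply: le_trans (gM y) _; rewrite lerD2l ge_min lexx.
have [psi psiE] : exists psi : lipb X, forall y, psi y = g (\val y).
  by apply: (@lipb_exists _ _ _ _ 2 1) => *; [exact: gM|exact: gL].
have psi2 : lipb_le psi 2.
  split=> [y|y z]; rewrite !psiE//; apply: le_trans (gL _ _) _.
  by rewrite ler_wpM2r ?enorm_ge0// ler1n.
have sE (h : X -> R) : \sum_(ax <- s) ax.1 * h ax.2 = \sum_i v0 ord0 i * h (x i).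
  by rewrite big_tnth; apply: eq_bigr => i _; rewrite mxE.
have two0 : 0 < 2 :> R by [].
have h1 := dual_bound (delta_combZ s) sD two0 psi2.
rewrite /delta_comb (sE psi) in h1.
have h2 : \sum_i v0 ord0 i * (f i / c0) <= 3 * D.
  apply: (@le_trans _ _ (\sum_i (v0 ord0 i * psi (x i) + `|v0 ord0 i| * eta))).
    apply: ler_sum => i _; rewrite -lerBlDl -mulrBr.
    apply: le_trans (ler_norm _) _; rewrite normrM ler_wpM2l// distrC psiE.
    by apply: (gf (\val (x i), f i / c0)); apply/mapP; exists i => //; rewrite mem_enum.
  rewrite big_split/= -mulr_suml -/S.
  have := le_trans (ler_norm _) h1; lra.
have h3 : flux_cost x v0 < 4 * c0 * D.
  apply: le_lt_trans pf _.
  apply: (@le_lt_trans _ _ (c0 * (3 * D))).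
    rewrite (_ : \sum_i _ = c0 * \sum_i v0 ord0 i * (f i / c0)).
      by rewrite ler_wpM2l// ltW.
    rewrite mulr_sumr; apply: eq_bigr => i _.
    by rewrite mulrCA [c0 * _]mulrC divfK// gt_eqF.
  rewrite (_ : 4 * c0 * D = c0 * (4 * D)); last by ring.
  by rewrite ltr_pM2l// ltr_pM2r// ltr_nat.
have hi : has_inf [set c | flux U Lambda (flux_comb x v0) c].
  by split; [exact: flux_cost_nonempty|exists 0 => c; exact: flux_ge0].
have gap : 0 < 4 * c0 * D - flux_cost x v0 by rewrite subr_gt0.
have [c /= fc] := inf_adherent gap hi.
rewrite -/(flux_cost x v0) addrC subrK => /ltW cle.
apply: flux_ext (flux_le cle fc) => phi _.
by rewrite (sE (fun y => bdval U phi (\val y))).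
Qed.

End arens_eells_flux.

(** * Surjectivity *)

Section main.
Context {R : realType} {n : nat} (U : set 'rV[R]_n).
Hypothesis U_open : open U.
Hypothesis U_qc : locally_uniformly_quasiconvex U.
Local Notation X := (boundary U).

Lemma boundary_lipb phi : C1b U phi -> exists psi : lipb X,
  (forall x, psi x = bdval U phi (\val x)) /\ boundary_value phi psi.
Proof.
move=> Cphi; have [M M0 HM] := C1b_jet_bound Cphi.
have [K K0 HK] := bdval_lipschitz U_open U_qc Cphi.
have cl (x : X) : closure U (\val x).
  by have /(boundary_open U_open)[] : X (\val x) := set_valP x.
have [psi psiE] : exists psi : lipb X, forall x, psi x = bdval U phi (\val x).
  apply: (@lipb_exists _ _ _ _ M K) => [x|x y]; last exact: HK.
  exact: bdval_le Cphi (cl x) (HM None).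
exists psi; split=> // x; rewrite psiE; exact: bdval_cvg.
Qed.

Lemma sum_geometric (K : nat) : \sum_(k < K) (2 ^+ k)^-1 <= 2 :> R.
Proof.
suff -> : \sum_(k < K) (2 ^+ k)^-1 = 2 - 2 * (2 ^+ K)^-1 :> R.
  by rewrite gerBl mulr_ge0// invr_ge0 exprn_ge0.
elim: K => [|K IH]; first by rewrite big_ord0 expr0 invr1 mulr1 subrr.
by rewrite big_ord_recr/= IH exprS invfM mulrA divff// mul1r; ring.
Qed.

(** Approximations [s k] with errors [D / 2 ^ k] give the telescoping series of
    the combinations [T k], whose costs sum to at most [16 c0 D]. *)
Lemma flux_arens_eells (Lambda : set 'rV[R]_n) (c0 : R) (m : arens_eells X)
    (D : R) :
  0 < c0 ->
  (forall x, X x -> flux U Lambda (fun phi => bdval U phi x) c0) ->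
  (forall x y, X x -> X y ->
    flux U Lambda (fun phi => bdval U phi x - bdval U phi y)
      (c0 * enorm (x - y))) ->
  0 < D -> (dual_norm m <= D%:E)%E ->
  exists2 ell, flux U Lambda ell (16 * c0 * D) &
    forall phi (psi : lipb X), C1b U phi -> (forall x, psi x = bdval U phi (\val x)) ->
      ell phi = m psi.
Proof.
move=> c0_gt0 fx fxy D0 mD.
pose e k : R := D * (2 ^+ k)^-1.
have e0 k : 0 < e k by rewrite mulr_gt0// invr_gt0 exprn_gt0.
have [s Hs] : exists s : nat -> seq (R * X), s 0%N = [::] /\
    forall k f, lipb_norm f <= 1 -> `|m f - delta_comb (s k) f| <= e k.
  have [t Ht] := choice (fun k => ae_approx m (e0 k)).
  (* starting from the empty combination makes the series sum up to [m] *)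
  exists (fun k => if k is 0 then [::] else t k); split=> // -[|k] f f1.
    rewrite /delta_comb big_nil subr0 /e expr0 invr1 mulr1.
    exact: (dual_norm_le mD).
  exact: Ht.
have {Hs} [s0 Hs] := Hs.
pose T k := s k.+1 ++ [seq (- ax.1, ax.2) | ax <- s k].
have TE k (h : X -> R) : \sum_(ax <- T k) ax.1 * h ax.2 =
    \sum_(ax <- s k.+1) ax.1 * h ax.2 - \sum_(ax <- s k) ax.1 * h ax.2.
  rewrite big_cat big_map/= -sumrN; congr (_ + _).
  by apply: eq_bigr => ax _; rewrite mulNr.
have e2 k : 0 < 2 * e k by rewrite mulr_gt0.
have eS k : e k.+1 <= e k.
  rewrite /e ler_pM2l// exprS invfM ger_pMl ?invr_gt0 ?exprn_gt0//.
  by rewrite invf_le1// ler1n.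
have fT k : flux U Lambda
    (fun phi => \sum_(ax <- T k) ax.1 * bdval U phi (\val ax.2))
    (4 * c0 * (2 * e k)).
  apply: flux_delta_comb => // f f1.
  rewrite /delta_comb TE.
  apply: le_trans (_ : `|m f - delta_comb (s k) f| +
      `|m f - delta_comb (s k.+1) f| <= _).
    apply: le_trans (ler_normB _ _); rewrite le_eqVlt; apply/orP; left.
    apply/eqP; congr `|_|; rewrite /delta_comb; ring.
  have := Hs k f f1; have := Hs k.+1 f f1; have := eS k; lra.
have ex phi : exists psi : lipb X,
    C1b U phi -> forall x, psi x = bdval U phi (\val x).
  have [Cphi|nCphi] := pselect (C1b U phi); last by exists 0.
  by have [psi [psiE _]] := boundary_lipb Cphi; exists psi.
have [psi_ Hpsi] := choice ex.
exists (fun phi => m (psi_ phi)); last first.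
  move=> phi psi Cphi psiE; congr (m _); apply: lipb_ext => x.
  by rewrite Hpsi// psiE.
apply: (flux_series U_open fT) => [K|phi Cphi].
  rewrite (_ : \sum_(k < K) _ = 8 * c0 * D * \sum_(k < K) (2 ^+ k)^-1).
    rewrite (_ : 16 * c0 * D = 8 * c0 * D * 2); last by ring.
    by rewrite ler_wpM2l ?sum_geometric// ltW// !mulr_gt0.
  by rewrite mulr_sumr; apply: eq_bigr => k _; rewrite /e; ring.
have [A A0 psiA] := lipb_le_exists (psi_ phi).
have partial_sum K : \sum_(k < K) \sum_(ax <- T k) ax.1 * bdval U phi (\val ax.2) =
    delta_comb (s K) (psi_ phi).
  transitivity (\sum_(k < K) (delta_comb (s k.+1) (psi_ phi) -
      delta_comb (s k) (psi_ phi))).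
    apply: eq_bigr => k _; rewrite /delta_comb -TE.
    by apply: eq_bigr => ax _; rewrite Hpsi.
  rewrite -(big_mkord xpredT (fun k => delta_comb (s k.+1) (psi_ phi) -
    delta_comb (s k) (psi_ phi))) telescope_sumr//.
  by rewrite s0 /delta_comb big_nil subr0.
under eq_cvg do rewrite partial_sum.
have close K : `|m (psi_ phi) - delta_comb (s K) (psi_ phi)| <= e K * A.
  exact: dual_bound (ae_approxZ m (s K)) (Hs K) A0 psiA.
apply/cvgrPdist_le => r r0.
have eA : (fun K => A * D * 2^-1 ^+ K) @ \oo --> (0 : R).
  rewrite -(mulr0 (A * D)); apply: cvgMr.
  by apply: cvg_expr; rewrite ger0_norm// invf_lt1// ltr1n.
have /cvgrPdist_le/(_ _ r0) := eA; apply: filterS => K.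
rewrite sub0r normrN => h; apply: le_trans (close K) _.
by rewrite /e -exprVn mulrC mulrA; apply: le_trans (ler_norm _) h.
Qed.

Lemma normal_trace_surjective : exists (Lambda : set 'rV[R]_n) (C : R),
  [/\ Lambda `<=` U, discrete_set Lambda &
      forall m : arens_eells X, exists F : DMext U,
        [/\ is_normal_trace F m,
            charge_abs (dm_div F) (U `\` Lambda) = 0%E &
            (DMext_norm F <= C%:E * ae_norm m)%E]].
Proof.
have [Lambda [c0 [[LU dL cL c0_gt0] [fx fxy]]]] := flux_boundary U_open U_qc.
exists Lambda, ((n%:R + 1) * (16 * c0)); split=> // m.
have m_ge0 : (0 <= dual_norm m)%E.
  apply: ereal_sup_ubound; exists 0; last by rewrite linear0 normr0.
  apply: lipb_norm_le => //; split=> [x|x y].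
    by rewrite normr0.
  by rewrite subrr normr0 mulr_ge0// enorm_ge0.
have mfin : dual_norm m \is a fin_num by rewrite ge0_fin_numE// ae_bounded.
pose D := fine (dual_norm m).
have mDE : dual_norm m = D%:E by rewrite fineK.
have [ell fl ellE] : exists2 ell, flux U Lambda ell (16 * c0 * D) &
    forall phi (psi : lipb X), C1b U phi -> (forall x, psi x = bdval U phi (\val x)) ->
      ell phi = m psi.
  have : 0 <= D by rewrite fine_ge0.
  rewrite le_eqVlt => /predU1P[D0|D0]; last first.
    by apply: (flux_arens_eells c0_gt0 fx fxy D0); rewrite mDE.
  exists (fun=> 0); first by rewrite -D0 mulr0; exact: flux0.
  move=> phi psi _ _; have [A A0 psiA] := lipb_le_exists psi.
  apply/esym/eqP; rewrite -normr_le0 -(mul0r A).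
  apply: dual_bound psiA => // [a f|]; first exact: linearZ.
  by apply: dual_norm_le; rewrite mDE -D0.
have [|F [FE Fdiv Fle]] := flux_field U_open cL fl.
- move=> phi tphi; have Cphi := test_function_C1b tphi; split=> //.
  rewrite (ellE phi 0 Cphi) ?linear0// => x.
  by rewrite (test_function_bdval U_open tphi)//; exact: set_valP.
have Fm : normal_trace_identity F m.
  move=> phi Cphi; have [psi [psiE bpsi]] := boundary_lipb Cphi.
  by exists psi => //; rewrite -FE// (ellE phi psi).
exists F; split=> //.
- by split=> // m' Fm'; exact: normal_trace_unique Fm Fm'.
- by apply: le_trans Fle _; rewrite /ae_norm mDE -EFinM mulrA.
Qed.

End main.

Theorem theorem1p4 (R : realType) (n : nat) (n_ge2 : (2 <= n)%N)
    (U : set 'rV[R]_n) (U_open : open U)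
    (U_qc : locally_uniformly_quasiconvex U) :
  (forall m : arens_eells (boundary U),
    exists F : DMext U, is_normal_trace F m) /\
  (exists (Lambda : set 'rV[R]_n) (C : R),
    [/\ Lambda `<=` U,
        discrete_set Lambda &
        forall m : arens_eells (boundary U), exists F : DMext U,
          [/\ is_normal_trace F m,
              charge_abs (dm_div F) (U `\` Lambda) = 0%E &
              (DMext_norm F <= C%:E * ae_norm m)%E]]).
Proof.
have [Lambda [C [LU dL H]]] := normal_trace_surjective U_open U_qc.
split; last by exists Lambda, C.
by move=> m; have [F [Fm _ _]] := H m; exists F.
Qed.
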